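(* Let $(\mathcal M,g)$ be an oriented, time-oriented smooth Lorentzian surface with Ricci scalar $R$, let $\pi:O(\mathcal M)\to\mathcal M$ be its orthonormal frame bundle, and let $\overline g$ be the Schmidt metric on $O(\mathcal M)$ built from the Levi-Civita connection of $g$ and the Euclidean inner products on $\mathbb R^2$ and $\mathfrak{so}(1,1)\cong\mathbb R$. Then the Ricci scalar $\overline R$ of the Riemannian $3$-manifold $(O(\mathcal M),\overline g)$ satisfies $$\overline R=-\tfrac18\,(R\circ\pi)^2-2 .$$
   Context: The Lorentzian metric has signature $(-,+)$. $O(\mathcal M)$ is the principal $SO^+(1,1)$-bundle of oriented, time-oriented orthonormal frames $(\tilde E_1,\tilde E_2)$ of $(\mathcal M,g)$, with $\tilde E_1$ future-directed timelike. In local coordinates $x^a$ on $\mathcal M$, a frame has components $\tilde E_b=\beta^a{}_b\,\partial_a$. The solder form is the $\mathbb R^2$-valued 1-form $\theta$ with $\theta^a=\sum_c(\beta^{-1})^a{}_c\,dx^c$. The connection form of the Levi-Civita connection is the $\mathfrak{so}(1,1)$-valued 1-form $\varpi$ with $$\varpi^a{}_b=\sum_c(\beta^{-1})^a{}_c\Big(d\beta^c{}_b+\sum_{d,e}\Gamma^c{}_{de}\,\beta^e{}_b\,dx^d\Big),$$ where $\Gamma^c{}_{de}$ are the Christoffel symbols of $g$; both forms are restricted to $O(\mathcal M)$. Elements of $\mathfrak{so}(1,1)$ are the matrices $\begin{pmatrix}0&\lambda\\ \lambda&0\end{pmatrix}$; this Lie algebra is identified with $\mathbb R$ via $\lambda$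 and given the inner product $\lambda\lambda'$. The Schmidt metric is the Riemannian metric $\overline g(X,Y)=\theta(X)\cdot\theta(Y)+\varpi(X)\cdot\varpi(Y)$ on $O(\mathcal M)$, with the standard dot product on $\mathbb R^2$ and, on $\mathfrak{so}(1,1)$, the inner product of $\begin{pmatrix}0&\lambda\\ \lambda&0\end{pmatrix}$ and $\begin{pmatrix}0&\lambda'\\ \lambda'&0\end{pmatrix}$ equal to $\lambda\lambda'$. The Ricci scalar is the full trace of the Ricci tensor, with the sign convention in which round spheres have positive scalar curvature. *)

(* Defs.v *)
From HB Require Import structures.
From mathcomp Require Import all_boot all_order all_algebra.
From mathcomp Require Import all_classical all_reals all_analysis.

Set Implicit Arguments.
Unset Strict Implicit.
Unset Printing Implicit Defensive.

Import Order.TTheory GRing.Theory Num.Theory.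
Import numFieldNormedType.Exports.

Local Open Scope classical_set_scope.
Local Open Scope ring_scope.

Section Calculus.
Variables (R : realType) (n : nat).
Implicit Types (f : 'rV[R]_n -> R) (U : set 'rV[R]_n).

Definition partial (i : 'I_n) f : 'rV[R]_n -> R :=
  fun x => 'D_(delta_mx 0 i) f x.

(* C^oo: every iterated partial derivative exists and is (Frechet)
   differentiable.  Only used on open sets U. *)
Definition smooth_on U f : Prop :=
  forall (s : seq 'I_n) (x : 'rV[R]_n), U x ->
    differentiable (foldr partial f s) x.

Variable g : 'rV[R]_n -> 'M[R]_n.

(* Gamma^c_{de} *)
Definition christoffel (c d e : 'I_n) (x : 'rV[R]_n) : R :=
  2^-1 * \sum_(f < n) invmx (g x) c f *
    (partial d (fun z => g z f e) x + partial e (fun z => g z f d) x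
     - partial f (fun z => g z d e) x).

(* R^a_{bcd} = d_c Gamma^a_{db} - d_d Gamma^a_{cb} + ..., so that with
   R_{bd} = R^a_{bad} round spheres have positive scalar curvature. *)
Definition riemann (a b c d : 'I_n) (x : 'rV[R]_n) : R :=
  partial c (christoffel a d b) x - partial d (christoffel a c b) x
  + \sum_(e < n) (christoffel a c e x * christoffel e d b x
                  - christoffel a d e x * christoffel e c b x).

Definition ricci (b d : 'I_n) (x : 'rV[R]_n) : R :=
  \sum_(a < n) riemann a b a d x.

Definition coord_ricci_scalar (x : 'rV[R]_n) : R :=
  \sum_(b < n) \sum_(d < n) invmx (g x) b d * ricci b d x.

End Calculus.

Section Manifold.
Variables (R : realType) (n : nat).

Record chart (M : topologicalType) := Chart {
  chart_dom : set M;
  coord : M -> 'rV[R]_n;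
  coord_inv : 'rV[R]_n -> M;
  chart_cod : set 'rV[R]_n := coord @` chart_dom;
  chart_dom_open : open chart_dom;
  chart_cod_open : open chart_cod;
  coordK : forall p, chart_dom p -> coord_inv (coord p) = p;
  coord_continuous : {within chart_dom, continuous coord};
  coord_inv_continuous : {within chart_cod, continuous coord_inv} }.

Definition transition (M : topologicalType) (c c' : chart M)
  (x : 'rV[R]_n) : 'rV[R]_n := coord c' (coord_inv c x).

Definition overlap (M : topologicalType) (c c' : chart M) : set 'rV[R]_n :=
  coord c @` (chart_dom c `&` chart_dom c').

(* J^a_b = d x'^a / d x^b *)
Definition jac (M : topologicalType) (c c' : chart M) (x : 'rV[R]_n) : 'M[R]_n :=
  \matrix_(a, b) partial b (fun z => transition c c' z 0 a) x.

(* The orientation is the one for which all the charts of the atlas are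
   positively oriented. *)
Record oriented_manifold := OrientedManifold {
  carrier :> topologicalType;
  manifold_hausdorff : hausdorff_space carrier;
  manifold_second_countable : @second_countable carrier;
  atlas : set (chart carrier);
  atlas_cover : forall p : carrier, exists c, atlas c /\ chart_dom c p;
  atlas_smooth : forall c c', atlas c -> atlas c' ->
    forall a : 'I_n, smooth_on (overlap c c') (fun x => transition c c' x 0 a);
  atlas_oriented : forall c c', atlas c -> atlas c' ->
    forall x, overlap c c' x -> 0 < \det (jac c c' x) }.

(* A chosen chart around p.  Tangent vectors at p are represented by their
   components in this chart, and quantities that do not depend on the chart,
   such as the Ricci scalar, are computed in it. *)
Definition chart_at (M : oriented_manifold) (p : M) : chart M :=
  sval (cid (atlas_cover p)).

End Manifold.

Section LorentzianSurface.
Variable R : realType.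

Definition minkowski : 'M[R]_2 :=
  \matrix_(i, j) (if i == j then (if i == 0 then -1 else 1) else 0).

Definition lorentzian_form (A : 'M[R]_2) : Prop :=
  A^T = A /\ exists2 P : 'M[R]_2, P \in unitmx & P^T *m A *m P = minkowski.

(* The metric is given by its components metric c in each chart c of the atlas
   and the time orientation by a smooth timelike vector field, with components
   time_field c, to be regarded as future directed. *)
Record lorentzian_surface := LorentzianSurface {
  surface :> oriented_manifold R 2;
  metric : chart R 2 surface -> 'rV[R]_2 -> 'M[R]_2;
  metric_smooth : forall c, atlas c -> forall a b : 'I_2,
    smooth_on (chart_cod c) (fun x => metric c x a b);
  metric_lorentzian : forall c, atlas c -> forall x, chart_cod c x ->
    lorentzian_form (metric c x);
  metric_tensor : forall c c', atlas c -> atlas c' ->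
    forall p, chart_dom c p -> chart_dom c' p ->
    metric c (coord c p) = (jac c c' (coord c p))^T
      *m metric c' (coord c' p) *m jac c c' (coord c p);
  time_field : chart R 2 surface -> 'rV[R]_2 -> 'cV[R]_2;
  time_field_smooth : forall c, atlas c -> forall a : 'I_2,
    smooth_on (chart_cod c) (fun x => time_field c x a 0);
  time_field_timelike : forall c, atlas c -> forall x, chart_cod c x ->
    ((time_field c x)^T *m metric c x *m time_field c x) 0 0 < 0;
  time_field_tensor : forall c c', atlas c -> atlas c' ->
    forall p, chart_dom c p -> chart_dom c' p ->
    time_field c' (coord c' p) = jac c c' (coord c p) *m time_field c (coord c p)
}.

Definition ricci_scalar (M : lorentzian_surface) (p : M) : R :=
  coord_ricci_scalar (metric (chart_at p)) (coord (chart_at p) p).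

(* A point of O(M): a point p of M and a frame E_b = beta^a_b d_a at p, given
   by its components in chart_at p (column b of frame_mx is E_b). *)
Record orthonormal_frame (M : lorentzian_surface) := OrthonormalFrame {
  frame_pt : M;
  frame_mx : 'M[R]_2;
  frame_orthonormal :
    let c := chart_at frame_pt in
    frame_mx^T *m metric c (coord c frame_pt) *m frame_mx = minkowski;
  frame_oriented : 0 < \det frame_mx;
  frame_future :
    let c := chart_at frame_pt in
    ((time_field c (coord c frame_pt))^T *m metric c (coord c frame_pt)
      *m col 0 frame_mx) 0 0 < 0 }.

Definition frame_comp (M : lorentzian_surface) (c : chart R 2 M)
    (u : orthonormal_frame M) : 'M[R]_2 :=
  let c0 := chart_at (frame_pt u) in
  jac c0 c (coord c0 (frame_pt u)) *m frame_mx u.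

(* Over a chart c of M the frame bundle F(M) has the coordinates (x, beta), in
   which a tangent vector is a pair (dx, dbeta). *)

Definition solder (beta : 'M[R]_2) (dx : 'rV[R]_2) : 'cV[R]_2 :=
  \col_a \sum_(c < 2) invmx beta a c * dx 0 c.

Definition connection (g : 'rV[R]_2 -> 'M[R]_2) (x : 'rV[R]_2)
    (beta : 'M[R]_2) (dx : 'rV[R]_2) (dbeta : 'M[R]_2) : 'M[R]_2 :=
  \matrix_(a, b) \sum_(c < 2) invmx beta a c *
    (dbeta c b
     + \sum_(d < 2) \sum_(e < 2) christoffel g c d e x * beta e b * dx 0 d).

(* so(1,1) ~ R, (0 l; l 0) |-> l *)
Definition so11_coord (A : 'M[R]_2) : R := A 0 1.

Definition schmidt_form (g : 'rV[R]_2 -> 'M[R]_2) (x : 'rV[R]_2)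
    (beta : 'M[R]_2) (X Y : 'rV[R]_2 * 'M[R]_2) : R :=
  \sum_(a < 2) solder beta X.1 a 0 * solder beta Y.1 a 0
  + so11_coord (connection g x beta X.1 X.2)
    * so11_coord (connection g x beta Y.1 Y.2).

Section LocalParametrization.
Variables (M : lorentzian_surface) (c : chart R 2 M).
Variable psi : 'rV[R]_3 -> orthonormal_frame M.

Definition base_coord (y : 'rV[R]_3) : 'rV[R]_2 := coord c (frame_pt (psi y)).

Definition fibre_coord (y : 'rV[R]_3) : 'M[R]_2 := frame_comp c (psi y).

(* the i-th coordinate vector field of psi, in the coordinates (x, beta) *)
Definition tangent (i : 'I_3) (y : 'rV[R]_3) : 'rV[R]_2 * 'M[R]_2 :=
  (\row_a partial i (fun z => base_coord z 0 a) y,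
   \matrix_(a, b) partial i (fun z => fibre_coord z a b) y).

(* O(M) is a 3-dimensional submanifold of F(M).  So psi is the inverse of a
   chart of O(M), with values in the open set V of R^3, iff it is an injective
   smooth immersion of V into F(M) with values in O(M). *)
Record local_parametrization (V : set 'rV[R]_3) : Prop := LocalParametrization {
  lp_open : open V;
  lp_dom : forall y, V y -> chart_dom c (frame_pt (psi y));
  lp_smooth_base : forall a : 'I_2, smooth_on V (fun y => base_coord y 0 a);
  lp_smooth_fibre : forall a b : 'I_2, smooth_on V (fun y => fibre_coord y a b);
  lp_injective : forall y z, V y -> V z -> psi y = psi z -> y = z;
  lp_immersion : forall y, V y -> forall v : 'rV[R]_3,
    \sum_(i < 3) v 0 i *: (tangent i y).1 = 0 ->
    \sum_(i < 3) v 0 i *: (tangent i y).2 = 0 -> v = 0 }.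

Definition schmidt_metric (y : 'rV[R]_3) : 'M[R]_3 :=
  \matrix_(i, j) schmidt_form (metric c) (base_coord y) (fibre_coord y)
                   (tangent i y) (tangent j y).

End LocalParametrization.

(* Computed in an arbitrary chart of O(M) around u, shrunk so as to lie over the
   domain of chart_at (frame_pt u); xget picks one value, which does not depend
   on the choice of the chart. *)
Definition schmidt_ricci_scalar (M : lorentzian_surface)
    (u : orthonormal_frame M) : R :=
  let c := chart_at (frame_pt u) in
  xget 0 [set r | exists psi V y,
    [/\ local_parametrization c psi V, V y, psi y = u
      & r = coord_ricci_scalar (schmidt_metric c psi) y]].

End LorentzianSurface.

(* Main.v *)
Require Import Defs.
From mathcomp Require Import all_boot all_order all_algebra.
From mathcomp Require Import all_classical all_reals all_analysis.
From mathcomp Require Import ring lra.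

Set Implicit Arguments.
Unset Strict Implicit.
Unset Printing Implicit Defensive.

Import Order.TTheory GRing.Theory Num.Theory.
Import numFieldNormedType.Exports.
(* MathComp also has a [coord] and a [minkowski]. *)
Import Defs.

Local Open Scope classical_set_scope.
Local Open Scope ring_scope.

(** On [O(M)] the forms [e0 = theta^0], [e1 = theta^1], [e2 = varpi^0_1] are an
    orthonormal coframe of the Schmidt metric, and Cartan's structure equations read
      [de0 = e1 /\ e2],  [de1 = - e2 /\ e0],  [de2 = k e0 /\ e1],
    where [k] is half the Ricci scalar of the base.  Writing the connection matrix of this
    coframe as [W_01 = a2 e2], [W_12 = a0 e0], [W_20 = a1 e1], torsion-freeness means
    [a1 + a2 = 1], [a2 + a0 = -1], [a0 + a1 = k].  The derivatives of [k] do not enter the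
    sectional curvatures of the coordinate planes of the coframe, and the scalar curvature
    is [2 (a0 a1 + a1 a2 + a2 a0) = - k^2 / 2 - 2].

    Both the passage from coordinates to a frame and Cartan's second equation on [O(M)] are
    instances of one fact: the curvature of the gauge transform [P^-1 (dP + Gam P)] of a
    connection [Gam] is [P^-1 curv(Gam) P].  A chart of [O(M)] is obtained by applying
    Gram-Schmidt to a fixed frame along [M] and boosting the result. *)

(** * Partial derivatives and smooth functions *)

(** A connection matrix in which each entry is a multiple of the third coframe form is the ansatz
    for left-invariant metrics on three-dimensional unimodular Lie groups, the case of constant [k].
    It survives for variable [k] because the torsion equations are linear algebra in the values of
    [a0], [a1], [a2] at a point.

    That the base curvature enters [de2] through a single scalar is not taken from the symmetries of
    the Riemann tensor. On the bundle the connection form takes values in the line spanned by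
    [boost_gen], so its curvature is an exterior derivative times [boost_gen]; comparison with the
    pulled-back base curvature puts the latter into so(1,1) too.

    The scalar curvature of [O(M)] is an [xget] with default 0 over all local parametrizations.
    Hence the formula is proved for an arbitrary parametrization, without special coordinates, and a
    parametrization through the given frame is constructed separately: if there were none, the value
    would be 0, whereas the right-hand side is at most -2. *)

Lemma near_eq_differentiable (R : realType) (V W : normedModType R)
    (f g : V -> W) (x : V) :
  {near x, f =1 g} -> differentiable f x -> differentiable g x.
Proof.
move=> fg df.
have -> : g = f + (g - f) by apply/funext => z /=; rewrite !fctE addrC subrK.
apply: differentiableD => //.
have h0 : {near x, (g - f) =1 (cst 0 : V -> W)}.
  by move: fg; apply: filterS => z; rewrite !fctE => ->; rewrite subrr.
have hx := nbhs_singleton h0.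
(* The difference vanishes near [x], so its derivative is zero; [diff_unique] wants this candidate
   as a continuous linear map. *)
pose Z : {linear V -> W} := \0.
have cZ : continuous Z by exact: cst_continuous.
have eZ : (g - f) \o shift x = cst ((g - f) x) + Z +o_ 0 id.
  apply/eqaddoP => e e0.
  have : \forall z \near (0 : V), (g - f) (z + x) = 0.
    by move: h0; rewrite (near_shift 0) subr0; apply: filterS => z.
  apply: filterS => z zx /=.
  rewrite !fctE /= in zx hx *.
  by rewrite zx hx addr0 subrr normr0 mulr_ge0 // ltW.
by apply/diff_locallyP; rewrite (diff_unique cZ eZ).
Qed.

Section PartialDerivatives.
Variables (R : realType) (n : nat).
Implicit Types (f g : 'rV[R]_n -> R) (U : set 'rV[R]_n) (x : 'rV[R]_n).

Lemma open_eq_near U f g x : open U -> U x -> (forall z, U z -> f z = g z) ->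
  {near x, f =1 g}.
Proof. by move=> oU Ux fg; apply: filterS (open_nbhs_nbhs (conj oU Ux)). Qed.

Lemma eq_on_differentiable U f g x : open U -> U x ->
  (forall z, U z -> f z = g z) -> differentiable f x -> differentiable g x.
Proof. by move=> oU Ux fg; apply: near_eq_differentiable (open_eq_near oU Ux fg). Qed.

Lemma eq_on_partial U f g i x : open U -> U x ->
  (forall z, U z -> f z = g z) -> partial i f x = partial i g x.
Proof. by move=> oU Ux fg; apply: near_eq_derive (open_eq_near oU Ux fg). Qed.

Section Rules.
Variables (i : 'I_n) (x : 'rV[R]_n).

Lemma partial_cst (a : R) : partial i (fun=> a) x = 0.
Proof. exact: derive_cst. Qed.

Lemma partialD f g : differentiable f x -> differentiable g x ->
  partial i (fun z => f z + g z) x = partial i f x + partial i g x.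
Proof. by move=> df dg; apply: deriveD; apply: diff_derivable. Qed.

Lemma partialM f g : differentiable f x -> differentiable g x ->
  partial i (fun z => f z * g z) x = partial i f x * g x + f x * partial i g x.
Proof.
move=> df dg; rewrite addrC [_ * g x]mulrC.
by apply: deriveM; apply: diff_derivable.
Qed.

Lemma partialV f : f x != 0 -> differentiable f x ->
  partial i (fun z => (f z)^-1) x = - (partial i f x * ((f x)^-1 * (f x)^-1)).
Proof.
move=> fx df; rewrite /partial deriveV //; last exact: diff_derivable.
by rewrite /GRing.scale /= mulNr mulrC expr2 invfM.
Qed.

Lemma differentiable_sumf (I : Type) (r : seq I) (P : pred I)
    (F : I -> 'rV[R]_n -> R) : (forall j, differentiable (F j) x) ->
  differentiable (fun z => \sum_(j <- r | P j) F j z) x.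
Proof.
move=> dF; elim: r => [|j r IH].
  under eq_fun do rewrite big_nil; exact: differentiable_cst.
under eq_fun do rewrite big_cons.
by case: (P j) => //; apply: differentiableD.
Qed.

Lemma partial_sum (I : Type) (r : seq I) (P : pred I)
    (F : I -> 'rV[R]_n -> R) : (forall j, differentiable (F j) x) ->
  partial i (fun z => \sum_(j <- r | P j) F j z) x =
  \sum_(j <- r | P j) partial i (F j) x.
Proof.
move=> dF; elim: r => [|j r IH].
  under eq_fun do rewrite big_nil; rewrite big_nil; exact: partial_cst.
under eq_fun do rewrite big_cons.
rewrite big_cons; case: (P j) => //.
by rewrite partialD ?IH //; apply: differentiable_sumf.
Qed.

End Rules.

Lemma partial_invariant f i x : (forall t, f (t *: delta_mx 0 i + x) = f x) ->
  partial i f x = 0.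
Proof.
move=> fx; rewrite /partial /derive.
under eq_fun do rewrite /= fx subrr scaler0.
by rewrite lim_cst.
Qed.

Lemma partial_coord i j x : partial i (fun z : 'rV[R]_n => z 0 j) x = (i == j)%:R.
Proof.
rewrite /partial.
have -> : 'D_(delta_mx 0 i) (fun z : 'rV[R]_n => z 0 j) x =
   ('D_(delta_mx 0 i) (id : 'rV[R]_n -> _) x) 0 j.
  by rewrite derive_mx ?mxE //.
by rewrite derive_id !mxE eqxx /= eq_sym.
Qed.

End PartialDerivatives.

Section ChainRule.
Variables (R : realType) (m n : nat).
Implicit Types (f : 'rV[R]_m -> R) (h : 'rV[R]_n -> 'rV[R]_m).

Lemma differentiable_rV h y :
  (forall j, differentiable (fun z => h z 0 j) y) -> differentiable h y.
Proof.
move=> dh.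
have -> : h = \sum_(j < m) (fun z => h z 0 j *: (delta_mx 0 j : 'rV[R]_m)).
  by apply/funext => z; rewrite fct_sumE [LHS]row_sum_delta.
by apply: differentiable_sum => j; apply: differentiableZl.
Qed.

Lemma differentiable_compr f h y :
  (forall j, differentiable (fun z => h z 0 j) y) -> differentiable f (h y) ->
  differentiable (fun z => f (h z)) y.
Proof. by move=> dh df; apply: differentiable_comp df; apply: differentiable_rV. Qed.

Lemma partial_comp f h y i :
  (forall j, differentiable (fun z => h z 0 j) y) -> differentiable f (h y) ->
  partial i (fun z => f (h z)) y =
  \sum_(j < m) partial j f (h y) * partial i (fun z => h z 0 j) y.
Proof.
move=> dh df; have dh' := differentiable_rV dh.
rewrite /partial deriveE; last exact: differentiable_comp.
transitivity ('d f (h y) ('d h y (delta_mx 0 i))).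
  exact: (congr1 (fun F : _ -> _ => F (delta_mx 0 i)) (diff_comp dh' df)).
have -> : 'd h y (delta_mx 0 i) =
    \row_j partial i (fun z => h z 0 j) y :> 'rV[R]_m.
  rewrite -deriveE // derive_mx; last exact: diff_derivable.
  by apply/rowP => j; rewrite !mxE.
rewrite [X in 'd f _ X]row_sum_delta linear_sum /=; apply: eq_bigr => j _.
by rewrite linearZ /= !mxE deriveE // mulrC.
Qed.

End ChainRule.

Section Smooth.
Variables (R : realType) (n : nat).
Implicit Types (f g : 'rV[R]_n -> R).
Variables (U : set 'rV[R]_n).
Hypothesis oU : open U.

(** Smoothness graded by order. The product rule brings back [f] and [g] undifferentiated, so
    closure properties go by induction on the order, not on a list of indices. *)
Fixpoint Ck (k : nat) f : Prop :=
  (forall x, U x -> differentiable f x) /\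
  (if k is k'.+1 then forall i, Ck k' (partial i f) else True).

Lemma smooth_onP f : smooth_on U f <-> forall k, Ck k f.
Proof.
split=> [sf k|H s x Ux].
  elim: k f sf => [|k IH] f sf /=;
    (split; [by move=> x; exact: (sf [::])|]) => // i.
  by apply: IH => s x Ux; rewrite -foldr_rcons; exact: sf.
move: (H (size s)); elim/last_ind: s f {H} => [|s i IH] f /=; first by case=> /(_ x Ux).
by rewrite size_rcons foldr_rcons => -[_ /(_ i)]; exact: IH.
Qed.

Lemma Ck_partial k f i : Ck k.+1 f -> Ck k (partial i f).
Proof. by case=> _; apply. Qed.

Lemma Ck_eq k f g : (forall x, U x -> f x = g x) -> Ck k f -> Ck k g.
Proof.
elim: k f g => [|k IH] f g fg /= [df Hf];
  (split; [by move=> x Ux; exact: (eq_on_differentiable oU Ux fg (df _ Ux))|]) => // i.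
by apply: IH (Hf i) => x Ux; exact: (eq_on_partial _ oU Ux fg).
Qed.

Lemma Ck_le k f : Ck k.+1 f -> Ck k f.
Proof.
elim: k f => [|k IH] f /= [df Hf]; split=> // i.
by apply: IH.
Qed.

Lemma Ck_cst k (a : R) : Ck k (fun=> a).
Proof.
elim: k a => [|k IH] a /=;
  (split; [by move=> x Ux; exact: differentiable_cst|]) => // i.
by apply: Ck_eq (IH 0) => x _; rewrite partial_cst.
Qed.

Lemma CkD k f g : Ck k f -> Ck k g -> Ck k (fun x => f x + g x).
Proof.
elim: k f g => [|k IH] f g /= [df Hf] [dg Hg]; 
  (split; [by move=> x Ux; apply: differentiableD; [exact: df|exact: dg]|]) => // i.
apply: Ck_eq (IH _ _ (Hf i) (Hg i)) => x Ux; rewrite partialD //; [exact: df|exact: dg].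
Qed.

Lemma CkM k f g : Ck k f -> Ck k g -> Ck k (fun x => f x * g x).
Proof.
elim: k f g => [|k IH] f g; first by
  move=> /= [df _] [dg _]; split=> // x Ux; apply: differentiableM; [exact: df|exact: dg].
move=> Hf Hg; have [df Hf'] := Hf; have [dg Hg'] := Hg; split=> [x Ux|i].
  by apply: differentiableM; [exact: df|exact: dg].
apply: (Ck_eq _ (CkD (IH _ _ (Hf' i) (Ck_le Hg)) (IH _ _ (Ck_le Hf) (Hg' i)))).
by move=> x Ux; rewrite partialM //; [exact: df|exact: dg].
Qed.

(* Covers [g = 1 / f] and [g = 1 / sqrt f], whose partial derivatives are
   [partial i f] times a polynomial in [g]. *)
Lemma Ck_autonomous (P : {poly R}) k f g :
  (forall x, U x -> differentiable g x) ->
  (forall i x, U x -> partial i g x = partial i f x * P.[g x]) ->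
  Ck k f -> Ck k g.
Proof.
move=> dg Hg; elim: k => [|k IH] Hf; first by split.
(* The derivative of [g] involves only [g] itself, already known to order [k], and a derivative of
   [f]; hence [g] gains one order. *)
split=> // i; have Hgk := IH (Ck_le Hf).
apply: (Ck_eq _ (CkM (Ck_partial i Hf) _)); first by move=> x Ux; rewrite Hg.
elim/poly_ind: P {Hg IH} => [|p c IHp].
  by apply: Ck_eq (Ck_cst k 0) => x _; rewrite horner0.
apply: (Ck_eq _ (CkD (CkM IHp Hgk) (Ck_cst k c))) => x _.
by rewrite hornerMXaddC.
Qed.

Lemma smooth_eq_on f g : (forall x, U x -> f x = g x) -> smooth_on U f -> smooth_on U g.
Proof. by move=> fg /smooth_onP H; apply/smooth_onP => k; apply: Ck_eq (H k). Qed.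

Lemma smooth_differentiable f x : smooth_on U f -> U x -> differentiable f x.
Proof. by move=> H Ux; exact: (H [::]). Qed.

Lemma smooth_partial f i : smooth_on U f -> smooth_on U (partial i f).
Proof. by move/smooth_onP => H; apply/smooth_onP => k; case: (H k.+1) => _; apply. Qed.

Lemma smooth_cst (a : R) : smooth_on U (fun=> a).
Proof. by apply/smooth_onP => k; exact: Ck_cst. Qed.

Lemma smoothD f g : smooth_on U f -> smooth_on U g -> smooth_on U (fun x => f x + g x).
Proof. by move=> /smooth_onP Hf /smooth_onP Hg; apply/smooth_onP => k; exact: CkD. Qed.

Lemma smoothM f g : smooth_on U f -> smooth_on U g -> smooth_on U (fun x => f x * g x).
Proof. by move=> /smooth_onP Hf /smooth_onP Hg; apply/smooth_onP => k; exact: CkM. Qed.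

Lemma smoothN f : smooth_on U f -> smooth_on U (fun x => - f x).
Proof.
move=> Hf; apply: (smooth_eq_on _ (smoothM (smooth_cst (-1)) Hf)) => x _.
by rewrite mulN1r.
Qed.

Lemma smoothB f g : smooth_on U f -> smooth_on U g -> smooth_on U (fun x => f x - g x).
Proof. by move=> Hf Hg; apply: smoothD => //; exact: smoothN. Qed.

Lemma smooth_sum (I : Type) (r : seq I) (P : pred I) (F : I -> 'rV[R]_n -> R) :
  (forall j, smooth_on U (F j)) -> smooth_on U (fun z => \sum_(j <- r | P j) F j z).
Proof.
move=> HF; elim: r => [|j r IH].
  by under eq_fun do rewrite big_nil; exact: smooth_cst.
under eq_fun do rewrite big_cons.
by case: (P j) => //; apply: smoothD.
Qed.

Lemma smooth_prod (I : Type) (r : seq I) (P : pred I) (F : I -> 'rV[R]_n -> R) :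
  (forall j, smooth_on U (F j)) -> smooth_on U (fun z => \prod_(j <- r | P j) F j z).
Proof.
move=> HF; elim: r => [|j r IH].
  by under eq_fun do rewrite big_nil; exact: smooth_cst.
under eq_fun do rewrite big_cons.
by case: (P j) => //; apply: smoothM.
Qed.

Lemma smoothV f : (forall x, U x -> f x != 0) -> smooth_on U f ->
  smooth_on U (fun x => (f x)^-1).
Proof.
move=> f0 Hf; have df x (Ux : U x) := smooth_differentiable Hf Ux.
move/smooth_onP : Hf => Hf; apply/smooth_onP => k.
apply: (@Ck_autonomous (- 'X^2) _ f) => // [x Ux|i x Ux].
  by apply: differentiableV; [exact: df|exact: f0].
rewrite partialV //; [|exact: f0|exact: df].
by rewrite hornerN hornerXn; ring.
Qed.

Lemma differentiable_invsqrt f x : 0 < f x -> differentiable f x ->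
  differentiable (fun z => (Num.sqrt (f z))^-1) x.
Proof.
move=> f0 df; apply: differentiableV; last by rewrite gt_eqF // sqrtr_gt0.
apply: (@differentiable_comp _ _ _ _ f Num.sqrt) => //.
by apply/derivable1_diffP; case: (is_derive1_sqrt f0).
Qed.

Lemma partial_invsqrt f i x : 0 < f x -> differentiable f x ->
  partial i (fun z => (Num.sqrt (f z))^-1) x =
  partial i f x * - (2^-1 * (Num.sqrt (f x))^-1 ^+ 3).
Proof.
move=> f0 df.
have ds : differentiable (fun z => Num.sqrt (f z)) x.
  apply: (@differentiable_comp _ _ _ _ f Num.sqrt) => //.
  by apply/derivable1_diffP; case: (is_derive1_sqrt f0).
have s0 : 0 < Num.sqrt (f x) by rewrite sqrtr_gt0.
rewrite partialV // ?gt_eqF //.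
set s := Num.sqrt (f x) in s0 *.
(* The derivative of the root is read off from [f = sqrt f * sqrt f], which holds near [x] because
   [f] stays positive there. *)
suff : partial i (fun z => Num.sqrt (f z)) x * (2 * s) = partial i f x.
  by move=> <-; field; rewrite gt_eqF.
have -> : partial i f x = partial i (fun z => Num.sqrt (f z) * Num.sqrt (f z)) x.
  apply: near_eq_derive.
  have : \forall z \near x, 0 < f z.
    have cf := differentiable_continuous df.
    exact: (cf _ (open_nbhs_nbhs (conj (@open_gt R 0) f0))).
  by apply: filterS => z fz; rewrite -expr2 sqr_sqrtr // ltW.
by rewrite partialM // -/s; ring.
Qed.

Lemma smooth_invsqrt f : (forall x, U x -> 0 < f x) -> smooth_on U f ->
  smooth_on U (fun x => (Num.sqrt (f x))^-1).
Proof.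
move=> f0 Hf; have df x (Ux : U x) := smooth_differentiable Hf Ux.
move/smooth_onP : Hf => Hf; apply/smooth_onP => k.
apply: (@Ck_autonomous (- (2^-1 *: 'X^3)) _ f) => // [x Ux|i x Ux].
  by apply: differentiable_invsqrt; [exact: f0|exact: df].
rewrite partial_invsqrt //; [|exact: f0|exact: df].
by rewrite hornerN hornerZ hornerXn.
Qed.

Lemma smooth_coord j : smooth_on U (fun x : 'rV[R]_n => x 0 j).
Proof.
apply/smooth_onP => -[|k]; (split; [by move=> x _; exact: differentiable_coord|]) => // i.
by apply: Ck_eq (Ck_cst k (i == j)%:R) => x _; rewrite partial_coord.
Qed.

Lemma smooth_continuous f x : smooth_on U f -> U x -> {for x, continuous f}.
Proof. by move=> Hf Ux; apply: differentiable_continuous; exact: smooth_differentiable. Qed.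

Lemma open_smooth_gt0 f : smooth_on U f -> open (U `&` [set x | 0 < f x]).
Proof.
move=> Hf; rewrite openE => x [Ux fx]; rewrite /interior.
apply: filterI; first exact: open_nbhs_nbhs.
exact: (smooth_continuous Hf Ux (open_nbhs_nbhs (conj (@open_gt R 0) fx))).
Qed.

End Smooth.

(** The chain rule yields composites of [h] with the partial derivatives of [f], so the induction on
    the order is over all smooth [f] at once. *)
Lemma smooth_comp (R : realType) (m n : nat) (U : set 'rV[R]_m) (V : set 'rV[R]_n)
    (f : 'rV[R]_m -> R) (h : 'rV[R]_n -> 'rV[R]_m) :
  open V -> (forall y, V y -> U (h y)) ->
  (forall j, smooth_on V (fun z => h z 0 j)) -> smooth_on U f ->
  smooth_on V (fun z => f (h z)).
Proof.
move=> oV VU sh sf; apply/smooth_onP => // k.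
elim: k f sf => [|k IH] f sf; 
  (split; [move=> y Vy; apply: differentiable_compr => [j|];
     [exact: smooth_differentiable (sh j) Vy
     |exact: smooth_differentiable sf (VU _ Vy)]|]) => // i.
have : Ck V k (fun y => \sum_(j < m) partial j f (h y) * partial i (fun z => h z 0 j) y).
  elim: (index_enum _) => [|j r IHr].
    by under eq_fun do rewrite big_nil; exact: Ck_cst.
  under eq_fun do rewrite big_cons.
  apply: CkD => //; apply: CkM => //.
  - by apply: IH; exact: smooth_partial.
  - exact: ((smooth_onP _ _).1 (smooth_partial i (sh j)) k).
apply: Ck_eq => // y Vy; rewrite partial_comp // => [j|].
  exact: smooth_differentiable (sh j) Vy.
exact: smooth_differentiable sf (VU _ Vy).
Qed.

(** * Symmetry of second partial derivatives *)

Section Schwarz.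
Variables (R : realType) (n : nat).
Implicit Types (f : 'rV[R]_n -> R) (x v w : 'rV[R]_n).

Lemma is_derive_line f x v (t : R) : differentiable f (x + t *: v) ->
  is_derive t 1 (fun s => f (x + s *: v)) ('D_v f (x + t *: v)).
Proof.
move=> df.
pose l (s : R) := s *: v.
pose g := cst x + l.
have dgl : is_diff t g (0 + l) by apply: is_diffD.
have dg : differentiable g t by exact: ex_diff.
have dfg : differentiable (f \o g) t by apply: differentiable_comp.
apply: DeriveDef; first exact: diff_derivable.
rewrite [LHS](deriveE _ dfg).
transitivity ('d f (g t) ('d g t 1)).
  exact: (congr1 (fun F : _ -> _ => F 1) (diff_comp dg df)).
rewrite deriveE //; congr ('d f _ _).
by rewrite diff_val fctE add0r /l scale1r.
Qed.

Lemma MVT_line (phi dphi : R -> R) (h : R) : 0 < h ->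
  (forall s, 0 <= s <= h -> is_derive s 1 phi (dphi s)) ->
  exists2 s, 0 < s < h & phi h - phi 0 = dphi s * h.
Proof.
move=> h0 dp.
have [s||s] := @MVT R phi dphi 0 h h0.
- by rewrite in_itv /= => /andP[s0 sh]; apply: dp; rewrite !ltW.
- apply: derivable_within_continuous => s; rewrite in_itv /= => sh.
  by case: (dp s sh).
- by rewrite in_itv /= subr0 => sh E; exists s.
Qed.

(** The mean value theorem twice: in direction [v] for the difference of [f] along two parallel
    segments, then in direction [w] for ['D_v f]. The second difference on the left is symmetric in
    [v] and [w]. *)
Lemma mixed_difference f x v w (h : R) : 0 < h ->
  (forall s t, 0 <= s <= h -> 0 <= t <= h ->
     differentiable f (x + s *: v + t *: w) /\
     differentiable ('D_v f) (x + s *: v + t *: w)) ->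
  exists s t, [/\ 0 < s < h, 0 < t < h &
   f (x + h *: v + h *: w) - f (x + h *: v) - f (x + h *: w) + f x =
   'D_w ('D_v f) (x + s *: v + t *: w) * h * h].
Proof.
move=> h0 H.
have hh : 0 <= h <= h by rewrite (ltW h0) lexx.
have h00 : 0 <= (0 : R) <= h by rewrite (ltW h0) andbT.
have [s|s sh E1] := @MVT_line (fun s => f (x + h *: w + s *: v) - f (x + s *: v))
  (fun s => 'D_v f (x + h *: w + s *: v) - 'D_v f (x + s *: v)) h h0.
  move=> sh; apply: is_deriveB; apply: is_derive_line.
    by rewrite addrAC; have [] := H _ _ sh hh.
  by have [] := H _ _ sh h00; rewrite scale0r addr0.
have sh' : 0 <= s <= h by case/andP: sh => *; rewrite !ltW.
have [t th|t th E2] := @MVT_line (fun t => 'D_v f (x + s *: v + t *: w))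
  (fun t => 'D_w ('D_v f) (x + s *: v + t *: w)) h h0.
  by apply: is_derive_line; have [] := H _ _ sh' th.
exists s, t; split => //.
rewrite -E2 scale0r addr0 [x + s *: v + _]addrAC -E1 !scale0r !addr0.
by rewrite [x + h *: w + _]addrAC; ring.
Qed.

Lemma partialC f (U : set 'rV[R]_n) i j x : open U -> U x -> smooth_on U f ->
  partial i (partial j f) x = partial j (partial i f) x.
Proof.
move=> oU Ux sf; apply/eqP; rewrite -subr_eq0 -normr_le0.
apply/ler_addgt0Pr => e e0; rewrite add0r.
have sij := smooth_partial i (smooth_partial j sf).
have sji := smooth_partial j (smooth_partial i sf).
have e2 : 0 < e / 2 by rewrite divr_gt0.
have cij := smooth_continuous sij Ux.
have cji := smooth_continuous sji Ux.
have Ud := open_nbhs_nbhs (conj oU Ux).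
have /nbhs_normP[d /= d0 Hd] : \forall z \near x, [/\ U z,
    `|partial i (partial j f) x - partial i (partial j f) z| < e / 2 &
    `|partial j (partial i f) x - partial j (partial i f) z| < e / 2].
  move/cvgrPdist_lt : cij => /(_ _ e2) N1.
  move/cvgrPdist_lt : cji => /(_ _ e2) N2.
  apply: filterS3 Ud N1 N2 => z Uz A B; exact: And3 Uz A B.
pose v : 'rV[R]_n := delta_mx 0 i; pose w : 'rV[R]_n := delta_mx 0 j.
(* Small enough that the parallelogram with sides [h v], [h w] at [x] stays in the ball of radius
   [d]; the summand 1 keeps the denominator positive. *)
pose h := d / (`|v| + `|w| + 1) / 2.
have N0 : 0 < `|v| + `|w| + 1 by rewrite ltr_wpDl ?addr_ge0.
have h0 : 0 < h by rewrite !divr_gt0.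
have hd s t : 0 <= s <= h -> 0 <= t <= h -> `|x - (x + s *: v + t *: w)| < d.
  move=> /andP[s0 sh] /andP[t0 th].
  rewrite -addrA opprD addrA subrr add0r normrN.
  rewrite (le_lt_trans (ler_normD _ _)) // !normrZ !ger0_norm //.
  have -> : d = h * 2 * (`|v| + `|w| + 1).
    by rewrite /h -[d / _ / 2 * 2]mulrA mulVf ?pnatr_eq0 // mulr1 divfK ?gt_eqF.
  have v0 := normr_ge0 v; have w0 := normr_ge0 w.
  have : s * `|v| <= h * `|v| by rewrite ler_wpM2r.
  have : t * `|w| <= h * `|w| by rewrite ler_wpM2r.
  have : 0 <= h * `|v| by rewrite mulr_ge0 // ltW.
  have : 0 <= h * `|w| by rewrite mulr_ge0 // ltW.
  move: h0; move: (`|v|) (`|w|) => a b; lra.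
have dd g s t : smooth_on U g -> 0 <= s <= h -> 0 <= t <= h ->
    differentiable g (x + s *: v + t *: w).
  by move=> sg sh th; apply: smooth_differentiable sg _; case: (Hd _ (hd _ _ sh th)).
have [s [t [sh th E1]]] := @mixed_difference f x v w h h0 (fun s t sh th =>
  conj (dd _ s t sf sh th) (dd _ s t (smooth_partial i sf) sh th)).
have [|t' [s' [th' sh' E2]]] := @mixed_difference f x w v h h0.
  move=> t' s' th' sh'; rewrite addrAC; split; first exact: dd.
  exact: (dd _ s' t' (smooth_partial j sf)).
have le a : 0 < a < h -> 0 <= a <= h by case/andP => *; rewrite !ltW.
have [_ _ D1] := Hd _ (hd _ _ (le _ sh) (le _ th)).
have := Hd _ (hd _ _ (le _ sh') (le _ th')); rewrite [x + s' *: v + _]addrAC.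
case=> _ D2 _.
(* Both mixed derivatives, each at its own intermediate point, equal the same second difference
   divided by [h * h]. *)
have E : partial j (partial i f) (x + s *: v + t *: w) =
    partial i (partial j f) (x + t' *: w + s' *: v).
  apply: (mulIf (lt0r_neq0 h0)); apply: (mulIf (lt0r_neq0 h0)).
  by rewrite -[LHS]E1 -[RHS]E2 [x + h *: w + _]addrAC; ring.
move: D1 D2; rewrite /= -E.
move: (partial i (partial j f) x) (partial j (partial i f) x) => a b.
move: (partial j (partial i f) _) => c D1 D2.
clear -D1 D2; apply: ltW; rewrite (splitr e); apply: le_lt_trans (ltrD D2 D1).
by rewrite (distrC b); apply: le_trans (ler_normD _ _); rewrite addrA subrK.
Qed.

End Schwarz.

(** * Matrix-valued functions, curvature and gauge transformations *)

(* Comparing two distinct partial derivatives by unfolding them into limits is very slow. *)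
Opaque partial.

Section MatrixFunctions.
Variables (R : realType) (n : nat) (U : set 'rV[R]_n).
Hypothesis oU : open U.

Definition dmx p q (i : 'I_n) (A : 'rV[R]_n -> 'M[R]_(p, q)) (x : 'rV[R]_n) :
    'M[R]_(p, q) :=
  \matrix_(a, b) partial i (fun z => A z a b) x.

Definition smooth_mx p q (A : 'rV[R]_n -> 'M[R]_(p, q)) : Prop :=
  forall a b, smooth_on U (fun x => A x a b).

Lemma eq_on_dmx p q i (A B : 'rV[R]_n -> 'M[R]_(p, q)) x :
  U x -> (forall z, U z -> A z = B z) -> dmx i A x = dmx i B x.
Proof.
move=> Ux AB; apply/matrixP => a b; rewrite !mxE.
by apply: (eq_on_partial _ oU Ux) => z Uz; rewrite AB.
Qed.

Lemma smooth_mx_eq p q (A B : 'rV[R]_n -> 'M[R]_(p, q)) :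
  (forall z, U z -> A z = B z) -> smooth_mx A -> smooth_mx B.
Proof.
by move=> AB sA a b; apply: smooth_eq_on (sA a b) => // x Ux; rewrite AB.
Qed.

Lemma smooth_mx_cst p q (A : 'M[R]_(p, q)) : smooth_mx (fun=> A).
Proof. by move=> a b; exact: smooth_cst. Qed.

Lemma smooth_mxD p q (A B : 'rV[R]_n -> 'M[R]_(p, q)) :
  smooth_mx A -> smooth_mx B -> smooth_mx (fun x => A x + B x).
Proof.
by move=> sA sB a b; under eq_fun do rewrite mxE; exact: smoothD.
Qed.

Lemma smooth_mxB p q (A B : 'rV[R]_n -> 'M[R]_(p, q)) :
  smooth_mx A -> smooth_mx B -> smooth_mx (fun x => A x - B x).
Proof.
move=> sA sB a b; under eq_fun do rewrite !mxE; exact: smoothB.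
Qed.

Lemma smooth_mxM p q r (A : 'rV[R]_n -> 'M[R]_(p, q)) (B : 'rV[R]_n -> 'M[R]_(q, r)) :
  smooth_mx A -> smooth_mx B -> smooth_mx (fun x => A x *m B x).
Proof.
move=> sA sB a b; under eq_fun do rewrite mxE.
by apply: smooth_sum => // j; exact: smoothM.
Qed.

Lemma smooth_mxZ p q (f : 'rV[R]_n -> R) (A : 'rV[R]_n -> 'M[R]_(p, q)) :
  smooth_on U f -> smooth_mx A -> smooth_mx (fun x => f x *: A x).
Proof.
by move=> sf sA a b; under eq_fun do rewrite mxE; exact: smoothM.
Qed.

Lemma smooth_mx_sum p q (I : Type) (r : seq I) (P : pred I)
    (A : I -> 'rV[R]_n -> 'M[R]_(p, q)) :
  (forall j, smooth_mx (A j)) -> smooth_mx (fun x => \sum_(j <- r | P j) A j x).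
Proof.
move=> sA a b; under eq_fun do rewrite summxE.
by apply: smooth_sum => // j; exact: sA.
Qed.

Lemma smooth_mx_tr p q (A : 'rV[R]_n -> 'M[R]_(p, q)) :
  smooth_mx A -> smooth_mx (fun x => (A x)^T).
Proof. by move=> sA a b; under eq_fun do rewrite mxE; exact: sA. Qed.

Lemma smooth_dmx p q i (A : 'rV[R]_n -> 'M[R]_(p, q)) :
  smooth_mx A -> smooth_mx (dmx i A).
Proof. by move=> sA a b; under eq_fun do rewrite mxE; exact: smooth_partial. Qed.

Lemma smooth_det p (A : 'rV[R]_n -> 'M[R]_p) :
  smooth_mx A -> smooth_on U (fun x => \det (A x)).
Proof.
move=> sA; rewrite /determinant; apply: smooth_sum => // s.
by apply: smoothM => //; [exact: smooth_cst|apply: smooth_prod].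
Qed.

Lemma smooth_invmx p (A : 'rV[R]_n -> 'M[R]_p) :
  (forall x, U x -> A x \in unitmx) -> smooth_mx A ->
  smooth_mx (fun x => invmx (A x)).
Proof.
move=> uA sA.
apply: (@smooth_mx_eq _ _ (fun x => (\det (A x))^-1 *: \adj (A x))).
  by move=> x Ux; rewrite /invmx uA.
apply: smooth_mxZ.
  apply: smoothV => // [x Ux|]; last exact: smooth_det.
  by rewrite -unitfE -unitmxE uA.
move=> a b; under eq_fun do rewrite mxE /cofactor.
apply: smoothM => //; first exact: smooth_cst.
by apply: smooth_det => i j; under eq_fun do rewrite !mxE; exact: sA.
Qed.

Section Rules.
Variables (i : 'I_n) (x : 'rV[R]_n).
Hypothesis Ux : U x.

Lemma dmxD p q (A B : 'rV[R]_n -> 'M[R]_(p, q)) : smooth_mx A -> smooth_mx B ->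
  dmx i (fun z => A z + B z) x = dmx i A x + dmx i B x.
Proof.
move=> sA sB; apply/matrixP => a b; rewrite !mxE.
under eq_fun do rewrite mxE.
by rewrite partialD //; apply: smooth_differentiable Ux.
Qed.

Lemma dmxM p q r (A : 'rV[R]_n -> 'M[R]_(p, q)) (B : 'rV[R]_n -> 'M[R]_(q, r)) :
  smooth_mx A -> smooth_mx B ->
  dmx i (fun z => A z *m B z) x = dmx i A x *m B x + A x *m dmx i B x.
Proof.
move=> sA sB; apply/matrixP => a b; rewrite !mxE.
under eq_fun do rewrite mxE.
rewrite partial_sum => [|j]; last first.
  by apply: differentiableM; apply: smooth_differentiable Ux.
rewrite -big_split /=; apply: eq_bigr => j _.
by rewrite partialM ?mxE //; apply: smooth_differentiable Ux.
Qed.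

Lemma dmxZ p q (f : 'rV[R]_n -> R) (A : 'rV[R]_n -> 'M[R]_(p, q)) :
  smooth_on U f -> smooth_mx A ->
  dmx i (fun z => f z *: A z) x = partial i f x *: A x + f x *: dmx i A x.
Proof.
move=> sf sA; apply/matrixP => a b; rewrite !mxE.
under eq_fun do rewrite mxE.
by rewrite partialM //; apply: smooth_differentiable Ux.
Qed.

Lemma dmx_sum p q (I : Type) (r : seq I) (P : pred I)
    (A : I -> 'rV[R]_n -> 'M[R]_(p, q)) : (forall j, smooth_mx (A j)) ->
  dmx i (fun z => \sum_(j <- r | P j) A j z) x = \sum_(j <- r | P j) dmx i (A j) x.
Proof.
move=> sA; apply/matrixP => a b; rewrite summxE !mxE.
under eq_fun do rewrite summxE.
rewrite partial_sum => [|j]; last by apply: smooth_differentiable Ux; exact: sA.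
by apply: eq_bigr => j _; rewrite mxE.
Qed.

Lemma dmx_tr p q (A : 'rV[R]_n -> 'M[R]_(p, q)) :
  dmx i (fun z => (A z)^T) x = (dmx i A x)^T.
Proof. by apply/matrixP => a b; rewrite !mxE; under eq_fun do rewrite mxE. Qed.

Lemma dmx_cst p q (A : 'M[R]_(p, q)) : dmx i (fun=> A) x = 0.
Proof. by apply/matrixP => a b; rewrite !mxE partial_cst. Qed.

Lemma dmxV p (A : 'rV[R]_n -> 'M[R]_p) : (forall z, U z -> A z \in unitmx) ->
  smooth_mx A ->
  dmx i (fun z => invmx (A z)) x = - (invmx (A x) *m dmx i A x *m invmx (A x)).
Proof.
move=> uA sA; have sV := smooth_invmx uA sA.
have : dmx i (fun z => invmx (A z) *m A z) x = 0.
  by rewrite -(dmx_cst (1%:M : 'M[R]_p)); apply: eq_on_dmx => // z Uz; rewrite mulVmx ?uA.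
rewrite dmxM // => /eqP; rewrite addr_eq0 => /eqP E.
by rewrite -mulNmx -E mulmxK ?uA.
Qed.

Lemma dmxC p q j (A : 'rV[R]_n -> 'M[R]_(p, q)) : smooth_mx A ->
  dmx i (dmx j A) x = dmx j (dmx i A) x.
Proof.
move=> sA; apply/matrixP => a b.
have E k l : dmx k (dmx l A) x a b = partial k (partial l (fun z => A z a b)) x.
  by rewrite mxE; congr (partial k _ x); apply/funext => z; rewrite mxE.
transitivity (partial i (partial j (fun z => A z a b)) x); first exact: E.
transitivity (partial j (partial i (fun z => A z a b)) x); last by rewrite E.
by move: (partialC i j oU Ux (sA a b)).
Qed.

End Rules.

(* A family [Gam] of matrices stands for the connection form [\sum_i Gam i dx^i]. *)
Definition curv p (Gam : 'I_n -> 'rV[R]_n -> 'M[R]_p) (i j : 'I_n) (x : 'rV[R]_n) :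
    'M[R]_p :=
  dmx i (Gam j) x - dmx j (Gam i) x + (Gam i x *m Gam j x - Gam j x *m Gam i x).

Definition gauge p (P : 'rV[R]_n -> 'M[R]_p) (Gam : 'I_n -> 'rV[R]_n -> 'M[R]_p)
    (i : 'I_n) (x : 'rV[R]_n) : 'M[R]_p :=
  invmx (P x) *m (dmx i P x + Gam i x *m P x).

Lemma eq_on_curv p (Gam Gam' : 'I_n -> 'rV[R]_n -> 'M[R]_p) i j x : U x ->
  (forall k z, U z -> Gam k z = Gam' k z) -> curv Gam i j x = curv Gam' i j x.
Proof.
move=> Ux E; rewrite /curv (E i x Ux) (E j x Ux).
by rewrite (eq_on_dmx _ Ux (E j)) (eq_on_dmx _ Ux (E i)).
Qed.

Lemma curv_anti p (Gam : 'I_n -> 'rV[R]_n -> 'M[R]_p) i j x :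
  curv Gam j i x = - curv Gam i j x.
Proof. by rewrite /curv opprD !opprB. Qed.

Section Gauge.
Variables (p : nat) (P : 'rV[R]_n -> 'M[R]_p) (Gam : 'I_n -> 'rV[R]_n -> 'M[R]_p).
Hypotheses (uP : forall x, U x -> P x \in unitmx) (sP : smooth_mx P)
  (sG : forall i, smooth_mx (Gam i)).

Lemma smooth_gauge i : smooth_mx (gauge P Gam i).
Proof.
apply: smooth_mxM; first exact: smooth_invmx.
by apply: smooth_mxD; [exact: smooth_dmx|exact: smooth_mxM].
Qed.

(** Antisymmetrizing the left side in [i], [j] gives the curvature. On the right, the second
    derivative of [P] and the bracketed cross terms are symmetric in [i], [j], so they will drop
    out. *)
Lemma dmx_gauge i j x : U x ->
  dmx i (gauge P Gam j) x + gauge P Gam i x *m gauge P Gam j x =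
  invmx (P x) *m (dmx i (dmx j P) x + dmx i (Gam j) x *m P x
    + (Gam j x *m dmx i P x + Gam i x *m dmx j P x)
    + Gam i x *m Gam j x *m P x).
Proof.
move=> Ux; have sV := smooth_invmx uP sP.
rewrite /gauge dmxM //; last by apply: smooth_mxD; [exact: smooth_dmx|exact: smooth_mxM].
rewrite dmxV // dmxD //; [|exact: smooth_dmx|exact: smooth_mxM].
rewrite dmxM //.
set Q := invmx _; set Pi := dmx i P x; set Pj := dmx j P x.
(* The first summand is what the derivative of [invmx P] contributes with the opposite sign. *)
have E : Q *m (Pi + Gam i x *m P x) *m (Q *m (Pj + Gam j x *m P x)) =
   Q *m Pi *m Q *m (Pj + Gam j x *m P x) + Q *m (Gam i x *m Pj + Gam i x *m Gam j x *m P x).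
  rewrite !(mulmxDr, mulmxDl, mulmxA).
  by rewrite !mulmxK ?uP // addrACA.
rewrite E mulNmx addrACA addNr add0r -mulmxDr; congr (Q *m _).
move: (dmx i (dmx j P) x) (dmx i (Gam j) x *m P x) (Gam j x *m Pi) => a b c.
by move: (Gam i x *m Pj) (Gam i x *m Gam j x *m P x) => d e; rewrite !addrA.
Qed.

Lemma curv_gauge i j x : U x ->
  curv (gauge P Gam) i j x = invmx (P x) *m curv Gam i j x *m P x.
Proof.
move=> Ux.
have -> : curv (gauge P Gam) i j x =
   (dmx i (gauge P Gam j) x + gauge P Gam i x *m gauge P Gam j x) -
   (dmx j (gauge P Gam i) x + gauge P Gam j x *m gauge P Gam i x).
  by rewrite /curv opprD addrACA.
rewrite (dmx_gauge i j Ux) (dmx_gauge j i Ux) -mulmxBr -[RHS]mulmxA; congr (_ *m _).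
rewrite /curv (dmxC i Ux j sP) !mulmxDl !mulNmx.
move: (dmx j (dmx i P) x) (dmx i (Gam j) x *m P x) (dmx j (Gam i) x *m P x) => a c d.
move: (Gam i x *m Gam j x *m P x) (Gam j x *m Gam i x *m P x) => e f.
move: (Gam j x *m dmx i P x) (Gam i x *m dmx j P x) => g h.
by apply/matrixP => s t; rewrite !mxE; ring.
Qed.

End Gauge.

End MatrixFunctions.

(** * Pullbacks and the Levi-Civita connection *)

Section Pullback.
Variables (R : realType) (m n : nat) (U : set 'rV[R]_m) (V : set 'rV[R]_n).
Hypotheses (oU : open U) (oV : open V).
Variables (h : 'rV[R]_n -> 'rV[R]_m).
Hypotheses (VU : forall y, V y -> U (h y))
  (sh : forall j, smooth_on V (fun z => h z 0 j)).

Lemma smooth_mx_comp p q (A : 'rV[R]_m -> 'M[R]_(p, q)) :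
  smooth_mx U A -> smooth_mx V (fun z => A (h z)).
Proof. by move=> sA a b; apply: (smooth_comp oV VU sh (sA a b)). Qed.

Lemma dmx_comp p q (A : 'rV[R]_m -> 'M[R]_(p, q)) i y : V y -> smooth_mx U A ->
  dmx i (fun z => A (h z)) y =
  \sum_(j < m) partial i (fun z => h z 0 j) y *: dmx j A (h y).
Proof.
move=> Vy sA; apply/matrixP => a b; rewrite summxE mxE.
rewrite (@partial_comp _ _ _ (fun x => A x a b)).
- by apply: eq_bigr => j _; rewrite !mxE mulrC.
- by move=> j; apply: smooth_differentiable Vy.
- by apply: smooth_differentiable (VU Vy).
Qed.

Definition pullback p (Gam : 'I_m -> 'rV[R]_m -> 'M[R]_p) (i : 'I_n) (y : 'rV[R]_n) :
    'M[R]_p :=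
  \sum_(d < m) partial i (fun z => h z 0 d) y *: Gam d (h y).

Variables (p : nat) (Gam : 'I_m -> 'rV[R]_m -> 'M[R]_p).
Hypothesis sG : forall d, smooth_mx U (Gam d).

Lemma smooth_pullback i : smooth_mx V (pullback Gam i).
Proof.
apply: smooth_mx_sum => // d; apply: smooth_mxZ => //.
- exact: smooth_partial.
- exact: smooth_mx_comp.
Qed.

Lemma dmx_pullback i j y : V y ->
  dmx i (pullback Gam j) y =
  \sum_(d < m) partial i (partial j (fun z => h z 0 d)) y *: Gam d (h y) +
  \sum_(c < m) \sum_(d < m)
    (partial i (fun z => h z 0 c) y * partial j (fun z => h z 0 d) y)
      *: dmx c (Gam d) (h y).
Proof.
move=> Vy.
have sp d : smooth_on V (partial j (fun z => h z 0 d)) by exact: smooth_partial.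
have sc d := smooth_mx_comp (sG d).
rewrite /pullback (dmx_sum i Vy) => [|d]; last exact: smooth_mxZ.
rewrite exchange_big /= -big_split /=; apply: eq_bigr => d _.
rewrite (dmxZ i Vy) //; congr (_ + _).
rewrite dmx_comp // scaler_sumr; apply: eq_bigr => c _.
by rewrite scalerA mulrC.
Qed.

(** The second derivatives of [h], collected in [S], cancel by [partialC]. The remaining terms are
    sums [W] over pairs of indices, in which exchanging [i] and [j] amounts to exchanging the
    summation indices. *)
Lemma curv_pullback i j y : V y ->
  curv (pullback Gam) i j y =
  \sum_(c < m) \sum_(d < m)
    (partial i (fun z => h z 0 c) y * partial j (fun z => h z 0 d) y)
      *: curv Gam c d (h y).
Proof.
move=> Vy.
pose X k c := partial k (fun z => h z 0 c) y.
pose S k l := \sum_(d < m) partial k (partial l (fun z => h z 0 d)) y *: Gam d (h y).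
pose W (F : 'I_m -> 'I_m -> 'M[R]_p) k l :=
  \sum_(c < m) \sum_(d < m) (X k c * X l d) *: F c d.
have prod k l : pullback Gam k y *m pullback Gam l y =
    W (fun c d => Gam c (h y) *m Gam d (h y)) k l.
  rewrite /pullback mulmx_suml; apply: eq_bigr => c _.
  rewrite mulmx_sumr; apply: eq_bigr => d _.
  by rewrite -scalemxAl -scalemxAr scalerA.
have SC : S j i = S i j.
  by apply: eq_bigr => d _; rewrite (partialC j i oV Vy (sh d)).
have WC F : W F j i = W (fun c d => F d c) i j.
  rewrite /W exchange_big /=; apply: eq_bigr => c _; apply: eq_bigr => d _.
  by rewrite mulrC.
have WB F F' : W F i j - W F' i j = W (fun c d => F c d - F' c d) i j.
  rewrite -sumrB; apply: eq_bigr => c _; rewrite -sumrB; apply: eq_bigr => d _.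
  by rewrite -scalerBr.
have WD F F' : W F i j + W F' i j = W (fun c d => F c d + F' c d) i j.
  rewrite -big_split /=; apply: eq_bigr => c _; rewrite -big_split.
  by apply: eq_bigr => d _; rewrite /= -scalerDr.
pose D c d := dmx c (Gam d) (h y).
have -> : curv (pullback Gam) i j y = (S i j + W D i j) - (S j i + W D j i) +
   (pullback Gam i y *m pullback Gam j y - pullback Gam j y *m pullback Gam i y).
  by rewrite /curv (dmx_pullback i j Vy) (dmx_pullback j i Vy).
rewrite (prod i j) (prod j i) SC !WC !WB opprD addrACA subrr add0r WB WD.
reflexivity.
Qed.

End Pullback.

Section LeviCivita.
Variables (R : realType) (n : nat) (U : set 'rV[R]_n) (g : 'rV[R]_n -> 'M[R]_n).
Hypotheses (oU : open U) (sg : smooth_mx U g)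
  (gS : forall x, U x -> (g x)^T = g x) (gU : forall x, U x -> g x \in unitmx).

Definition christoffel_mx (d : 'I_n) (x : 'rV[R]_n) : 'M[R]_n :=
  \matrix_(c, e) christoffel g c d e x.

(** Twice the Christoffel symbols of the first kind, with [d] fixed. *)
Let K (d : 'I_n) (x : 'rV[R]_n) : 'M[R]_n :=
  \matrix_(f, e) (dmx d g x f e + dmx e g x f d - dmx f g x d e).

Let christoffel_mxE d x : christoffel_mx d x = 2^-1 *: (invmx (g x) *m K d x).
Proof.
apply/matrixP => c e; rewrite !mxE /christoffel; congr (_ * _).
by apply: eq_bigr => f _; rewrite !mxE.
Qed.

Lemma smooth_christoffel d : smooth_mx U (christoffel_mx d).
Proof.
move=> c e; under eq_fun do rewrite mxE.
apply: smoothM => //; first exact: smooth_cst.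
apply: smooth_sum => // f; apply: smoothM => //.
  exact: (smooth_invmx oU gU sg).
have sp i a b : smooth_on U (partial i (fun z => g z a b)).
  exact: smooth_partial.
by apply: smoothB => //; apply: smoothD.
Qed.

Lemma christoffel_mx_sym d e c x : U x ->
  christoffel_mx d x c e = christoffel_mx e x c d.
Proof.
move=> Ux; rewrite !christoffel_mxE !mxE; congr (_ * _); apply: eq_bigr => f _.
rewrite !mxE; congr (_ * _).
have -> : partial f (fun z => g z d e) x = partial f (fun z => g z e d) x.
  by apply: (eq_on_partial _ oU Ux) => z Uz; rewrite -{1}gS // mxE.
by rewrite [X in X - _]addrC.
Qed.

Let dg_sym d x e f : U x -> dmx d g x e f = dmx d g x f e.
Proof.
move=> Ux; rewrite !mxE; apply: (eq_on_partial _ oU Ux) => z Uz.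
by rewrite -{1}gS // mxE.
Qed.

(** Metric compatibility: [K d x] differs from [dmx d g x] by an antisymmetric matrix, so half of
    its symmetrization is [dmx d g x]. *)
Lemma christoffel_metric d x : U x ->
  dmx d g x = g x *m christoffel_mx d x + (g x *m christoffel_mx d x)^T.
Proof.
move=> Ux; rewrite christoffel_mxE -scalemxAr mulKVmx ?gU //.
apply/matrixP => f e; rewrite [RHS]mxE [X in X + _]mxE [X in _ + X]mxE.
rewrite [X in _ + X]mxE [K d x f e]mxE [K d x e f]mxE.
have alg (p q r p' q' r' : R) : p' = p -> r' = r -> q' = q ->
    p = 2^-1 * (p + q - r) + 2^-1 * (p' + r' - q') by move=> -> -> ->; field.
exact: alg (dg_sym d e f Ux) (dg_sym f e d Ux) (dg_sym e d f Ux).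
Qed.

(** Koszul's argument at a single point: compatibility is substituted for the three derivatives in
    [K], and by the symmetry [Lsym] of the lower indices everything cancels except two copies of
    [g B_d]. *)
Lemma christoffel_unique (B : 'I_n -> 'M[R]_n) x : U x ->
  (forall c d e, B d c e = B e c d) ->
  (forall d, dmx d g x = g x *m B d + (g x *m B d)^T) ->
  forall d, christoffel_mx d x = B d.
Proof.
move=> Ux Bsym Bmet d.
have Lsym c i j : (g x *m B i) c j = (g x *m B j) c i.
  by rewrite !mxE; apply: eq_bigr => k _; rewrite Bsym.
rewrite christoffel_mxE.
suff -> : K d x = 2 *: (g x *m B d).
  by rewrite -scalemxAr scalerA mulVf ?pnatr_eq0 // scale1r mulKmx ?gU.
apply/matrixP => f e; rewrite [LHS]mxE [RHS]mxE !Bmet.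
have T i a b : (g x *m B i + (g x *m B i)^T) a b = (g x *m B i) a b + (g x *m B i) b a.
  by rewrite mxE [X in _ + X]mxE.
rewrite !T (Lsym f e d) (Lsym d e f) (Lsym e d f).
by move: ((g x *m B d) f e) ((g x *m B f) e d) ((g x *m B f) d e) => a b c; ring.
Qed.

Lemma riemannE a b c d x : riemann g a b c d x = curv christoffel_mx c d x a b.
Proof.
rewrite /riemann /curv !mxE; congr (_ - _ + _).
- by congr (partial c _ x); apply/funext => z; rewrite mxE.
- by congr (partial d _ x); apply/funext => z; rewrite mxE.
by rewrite sumrB; congr (_ - _); apply: eq_bigr => e _; rewrite !mxE.
Qed.

Lemma ricci_scalarE x :
  coord_ricci_scalar g x =
  \sum_a \sum_d (curv christoffel_mx a d x *m invmx (g x)) a d.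
Proof.
rewrite /coord_ricci_scalar exchange_big /= [RHS]exchange_big /=.
apply: eq_bigr => d _; under eq_bigr do rewrite /ricci mulr_sumr.
rewrite exchange_big /=; apply: eq_bigr => a _; rewrite mxE.
by apply: eq_bigr => b _; rewrite riemannE mulrC.
Qed.

End LeviCivita.

(** * Scalar curvature from an orthonormal coframe *)

Section Ord3.

Definition o0 : 'I_3 := @Ordinal 3 0 isT.
Definition o1 : 'I_3 := @Ordinal 3 1 isT.
Definition o2 : 'I_3 := @Ordinal 3 2 isT.

Lemma ord3_ind (P : 'I_3 -> Prop) : P o0 -> P o1 -> P o2 -> forall i, P i.
Proof.
move=> P0 P1 P2 [[|[|[|//]]] i3].
- by rewrite (_ : Ordinal i3 = o0) //; apply: val_inj.
- by rewrite (_ : Ordinal i3 = o1) //; apply: val_inj.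
- by rewrite (_ : Ordinal i3 = o2) //; apply: val_inj.
Qed.

Lemma sum3 (V : zmodType) (F : 'I_3 -> V) : \sum_(i < 3) F i = F o0 + F o1 + F o2.
Proof.
rewrite !big_ord_recl big_ord0 addr0 addrA.
by congr (F _ + F _ + F _); apply: val_inj.
Qed.

Lemma ord2_ind (P : 'I_2 -> Prop) : P 0 -> P 1 -> forall i, P i.
Proof.
move=> P0 P1 [[|[|//]] i2].
- by rewrite (_ : Ordinal i2 = 0) //; apply: val_inj.
- by rewrite (_ : Ordinal i2 = 1) //; apply: val_inj.
Qed.

Lemma sum2 (V : zmodType) (F : 'I_2 -> V) : \sum_(i < 2) F i = F 0 + F 1.
Proof.
rewrite !big_ord_recl big_ord0 addr0.
by congr (F _ + F _); apply: val_inj.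
Qed.

End Ord3.

Section CartanFrame.
Variables (R : realType) (n : nat) (V : set 'rV[R]_n).
Variables (E : 'rV[R]_n -> 'M[R]_n) (W : 'I_n -> 'rV[R]_n -> 'M[R]_n).
Hypotheses (oV : open V) (sE : smooth_mx V E) (uE : forall y, V y -> E y \in unitmx)
  (sW : forall i, smooth_mx V (W i)).

(** The rows of [E] are the components of the coframe forms, so [G] is the metric that makes the
    coframe orthonormal. *)
Let G y := (E y)^T *m E y.

Lemma frame_metric_unit y : V y -> G y \in unitmx.
Proof. by move=> Vy; rewrite unitmx_mul unitmx_tr uE. Qed.

Lemma frame_metric_sym y : V y -> (G y)^T = G y.
Proof. by move=> Vy; rewrite /G trmx_mul trmxK. Qed.

Hypothesis antiW : forall i y, V y -> (W i y)^T = - W i y.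
Hypothesis torsion : forall i j y, V y -> forall a,
  dmx i E y a j + (W i y *m E y) a j = dmx j E y a i + (W j y *m E y) a i.

(** The torsion equation gives the symmetry of the gauge transform in its lower indices and the
    antisymmetry of [W] gives its compatibility with [G]; uniqueness of the Levi-Civita connection
    does the rest. *)
Lemma frame_christoffel i y : V y -> christoffel_mx G i y = gauge E W i y.
Proof.
move=> Vy; apply: (@christoffel_unique R n V G frame_metric_unit
  (fun i => gauge E W i y) y Vy).
  move=> c d e; rewrite /gauge [LHS]mxE [RHS]mxE; apply: eq_bigr => a _.
  by congr (_ * _); rewrite [LHS]mxE [RHS]mxE; exact: torsion.
move=> d; rewrite /gauge /G.
have -> : (E y)^T *m E y *m (invmx (E y) *m (dmx d E y + W d y *m E y)) =
  (E y)^T *m dmx d E y + (E y)^T *m W d y *m E y.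
  by rewrite mulmxA mulmxK ?uE // mulmxDr mulmxA.
rewrite (dmxM d Vy (smooth_mx_tr sE) sE) dmx_tr.
rewrite [X in _ = _ + X]linearD /= !trmx_mul !trmxK (antiW d Vy).
rewrite mulNmx mulmxN mulmxA.
rewrite [(dmx d E y)^T *m _ - _]addrC addrA addrK.
by rewrite addrC.
Qed.

(** [curv_gauge] conjugates the curvature of [W] by [E], and the factor [E] on its right is absorbed
    by the inverse metric [invmx E *m (invmx E)^T]. *)
Lemma frame_scalar y : V y ->
  coord_ricci_scalar G y = \sum_A \sum_B \sum_a \sum_d
    invmx (E y) a A * invmx (E y) d B * curv W a d y A B.
Proof.
move=> Vy; rewrite ricci_scalarE.
have Ginv : invmx (G y) = invmx (E y) *m (invmx (E y))^T.
  apply: (can_inj (mulmxK (frame_metric_unit Vy))).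
  rewrite mulVmx ?frame_metric_unit // /G mulmxA -[_ *m _ *m (E y)^T]mulmxA.
  by rewrite -trmx_mul mulmxV ?uE // trmx1 mulmx1 mulVmx ?uE.
have H a d : (curv (christoffel_mx G) a d y *m invmx (G y)) a d =
    \sum_A \sum_B invmx (E y) a A * invmx (E y) d B * curv W a d y A B.
  rewrite (eq_on_curv oV a d Vy frame_christoffel) (curv_gauge oV uE sE sW a d Vy).
  rewrite Ginv mulmxA mulmxK ?uE // -mulmxA mxE; apply: eq_bigr => A _.
  rewrite mxE mulr_sumr; apply: eq_bigr => B _.
  by rewrite [_^T _ _]mxE; ring.
under eq_bigr do under eq_bigr do rewrite H.
under eq_bigr do rewrite exchange_big /=.
rewrite exchange_big /=; apply: eq_bigr => A _.
under eq_bigr do rewrite exchange_big /=.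
by rewrite exchange_big.
Qed.

End CartanFrame.

(** The 2-form [p /\ q] evaluated on the vectors [f] and [h], once through the values of [p] and [q]
    and once in coordinates. *)
Lemma wedge_sum (R : comNzRingType) n (p q f h : 'I_n -> R) :
  (\sum_a p a * f a) * (\sum_d q d * h d) - (\sum_a q a * f a) * (\sum_d p d * h d) =
  \sum_a \sum_d f a * h d * (p a * q d - p d * q a).
Proof.
rewrite !mulr_suml -sumrB; apply: eq_bigr => a _.
rewrite !mulr_sumr -sumrB; apply: eq_bigr => d _; ring.
Qed.

(** * Scalar curvature from the structure equations of the Schmidt coframe *)

Section Unimodular.
Variables (R : realType) (V : set 'rV[R]_3).
Variables (E : 'rV[R]_3 -> 'M[R]_3) (k : 'rV[R]_3 -> R).
Hypotheses (oV : open V) (sE : smooth_mx V E) (uE : forall y, V y -> E y \in unitmx)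
  (sk : smooth_on V k).

(** The parameters are the entries (1,2), (2,0), (0,1), each named after the complementary index. *)
Definition so3 (a b c : R) : 'M[R]_3 := \matrix_(p, q)
  nth 0 (nth [::] [:: [:: 0; c; - b]; [:: - c; 0; a]; [:: b; - a; 0]] p) q.

Lemma so3_lin (a b c : R) : so3 a b c = a *: so3 1 0 0 + b *: so3 0 1 0 + c *: so3 0 0 1.
Proof.
by apply/matrixP; apply: ord3_ind; apply: ord3_ind; rewrite !mxE /=; ring.
Qed.

(* The solution of [a1 + a2 = 1], [a2 + a0 = -1], [a0 + a1 = k]. *)
Let a0 y := (k y - 2) / 2.
Let a1 y := (k y + 2) / 2.
Let a2 y := - k y / 2.
Let w0 j y := a0 y * E y o0 j.
Let w1 j y := a1 y * E y o1 j.
Let w2 j y := a2 y * E y o2 j.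
Let W j y := so3 (w0 j y) (w1 j y) (w2 j y).

Let sa0 : smooth_on V a0.
Proof. by apply: smoothM; [|apply: smoothB|exact: smooth_cst] => //; exact: smooth_cst. Qed.
Let sa1 : smooth_on V a1.
Proof. by apply: smoothM; [|apply: smoothD|exact: smooth_cst] => //; exact: smooth_cst. Qed.
Let sa2 : smooth_on V a2.
Proof. by apply: smoothM; [|apply: smoothN|exact: smooth_cst]. Qed.
Let sw0 j : smooth_on V (w0 j). Proof. exact: smoothM. Qed.
Let sw1 j : smooth_on V (w1 j). Proof. exact: smoothM. Qed.
Let sw2 j : smooth_on V (w2 j). Proof. exact: smoothM. Qed.

Let WE j : W j = fun y => w0 j y *: so3 1 0 0 + w1 j y *: so3 0 1 0 + w2 j y *: so3 0 0 1.
Proof. by apply/funext => y; rewrite /W so3_lin. Qed.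

Let smooth_scaled f (A : 'M[R]_3) : smooth_on V f -> smooth_mx V (fun y => f y *: A).
Proof. by move=> sf; apply: smooth_mxZ => //; exact: smooth_mx_cst. Qed.

Let sW j : smooth_mx V (W j).
Proof.
by rewrite WE; do 2?apply: smooth_mxD => //; exact: smooth_scaled.
Qed.

Let dW i j y : V y -> dmx i (W j) y =
  so3 (partial i (w0 j) y) (partial i (w1 j) y) (partial i (w2 j) y).
Proof.
move=> Vy.
have dZ f (A : 'M[R]_3) : smooth_on V f ->
    dmx i (fun y => f y *: A) y = partial i f y *: A.
  move=> sf; rewrite (dmxZ i Vy sf (smooth_mx_cst oV A)) dmx_cst.
  by rewrite scaler0 addr0.
rewrite WE [RHS]so3_lin.
rewrite (dmxD i Vy); [|by apply: smooth_mxD => //; exact: smooth_scaled|exact: smooth_scaled].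
rewrite (dmxD i Vy); [|exact: smooth_scaled|exact: smooth_scaled].
by rewrite !dZ.
Qed.

Hypothesis dE0 : forall i j y, V y -> dmx i E y o0 j - dmx j E y o0 i =
  E y o1 i * E y o2 j - E y o1 j * E y o2 i.
Hypothesis dE1 : forall i j y, V y -> dmx i E y o1 j - dmx j E y o1 i =
  - (E y o2 i * E y o0 j - E y o2 j * E y o0 i).
Hypothesis dE2 : forall i j y, V y -> dmx i E y o2 j - dmx j E y o2 i =
  k y * (E y o0 i * E y o1 j - E y o0 j * E y o1 i).

Let antiW i y : V y -> (W i y)^T = - W i y.
Proof.
by move=> _; apply/matrixP; apply: ord3_ind; apply: ord3_ind; rewrite !mxE /=; ring.
Qed.

Let torsion i j y : V y -> forall a,
  dmx i E y a j + (W i y *m E y) a j = dmx j E y a i + (W j y *m E y) a i.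
Proof.
move=> Vy.
have D a x v z t : x - v = z -> z = t - a -> x + a = v + t :> R.
  by move=> <- H; apply/eqP; rewrite -subr_eq0 opprD addrACA H; apply/eqP; ring.
have M p l m : (W l y *m E y) p m =
    W l y p o0 * E y o0 m + W l y p o1 * E y o1 m + W l y p o2 * E y o2 m.
  by rewrite mxE sum3.
apply: ord3_ind.
- apply: (D _ _ _ _ _ (dE0 i j Vy)); by rewrite !M !mxE /= /w0 /w1 /w2 /a0 /a1 /a2; field.
- apply: (D _ _ _ _ _ (dE1 i j Vy)); by rewrite !M !mxE /= /w0 /w1 /w2 /a0 /a1 /a2; field.
- apply: (D _ _ _ _ _ (dE2 i j Vy)); by rewrite !M !mxE /= /w0 /w1 /w2 /a0 /a1 /a2; field.
Qed.

Section AtPoint.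
Variable y : 'rV[R]_3.
Hypothesis Vy : V y.

Let F := invmx (E y).

(** The columns of [F] are the frame dual to the coframe; this is the value of the 2-form [X] on its
    vectors [A] and [B]. *)
Let contract A B (X : 'I_3 -> 'I_3 -> R) := \sum_a \sum_d F a A * F d B * X a d.

Let contract_wedge A B (p q : 'I_3 -> R) :
  contract A B (fun a d => p a * q d - p d * q a) =
  (\sum_a p a * F a A) * (\sum_d q d * F d B) -
  (\sum_a q a * F a A) * (\sum_d p d * F d B).
Proof.
by rewrite wedge_sum.
Qed.

Let contractD A B X X' :
  contract A B (fun a d => X a d + X' a d) = contract A B X + contract A B X'.
Proof.
rewrite /contract -big_split; apply: eq_bigr => a _.
by rewrite /= -big_split; apply: eq_bigr => d _; rewrite /= mulrDr.
Qed.

Let contractZ A B c X :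
  contract A B (fun a d => c * X a d) = c * contract A B X.
Proof.
rewrite /contract mulr_sumr; apply: eq_bigr => a _.
by rewrite mulr_sumr; apply: eq_bigr => d _; ring.
Qed.

Let dual c A : \sum_a E y c a * F a A = (c == A)%:R.
Proof. by have := mulmxV (uE Vy) => /matrixP /(_ c A); rewrite !mxE. Qed.

Let dw (a : 'rV[R]_3 -> R) c i j : smooth_on V a ->
  partial i (fun z => a z * E z c j) y - partial j (fun z => a z * E z c i) y =
  (partial i a y * E y c j - partial j a y * E y c i)
  + a y * (dmx i E y c j - dmx j E y c i).
Proof.
move=> sa.
have da : differentiable a y by exact: smooth_differentiable sa Vy.
have dE l : differentiable (fun z => E z c l) y by exact: smooth_differentiable (sE c l) Vy.
by rewrite !partialM // !mxE; ring.
Qed.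

Let curvE i j A B : curv W i j y A B =
  so3 (partial i (w0 j) y - partial j (w0 i) y)
      (partial i (w1 j) y - partial j (w1 i) y)
      (partial i (w2 j) y - partial j (w2 i) y) A B +
  (\sum_p W i y A p * W j y p B - \sum_p W j y A p * W i y p B).
Proof.
rewrite /curv !dW //; move: A B.
have H (X Y Z T : 'M[R]_3) A B : (X - Y + (Z - T)) A B = X A B - Y A B + (Z A B - T A B).
  by rewrite !mxE.
move=> A B; rewrite H; congr (_ + (_ - _)); rewrite ?[LHS]mxE //.
by move: A B; apply: ord3_ind; apply: ord3_ind; rewrite !mxE /=; ring.
Qed.

(** [dW_01 + W_02 /\ W_21], split into [da2 /\ e2], which vanishes on the first two frame vectors,
    and a multiple of [e0 /\ e1], whose coefficient is the sectional curvature. The next two are its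
    cyclic analogues, with the coefficients 1 and -1 of [de0] and [de1] in place of [k]. *)
Let curv01 i j : curv W i j y o0 o1 =
  (partial i a2 y * E y o2 j - partial j a2 y * E y o2 i) +
  (a2 y * k y - a0 y * a1 y) * (E y o0 i * E y o1 j - E y o0 j * E y o1 i).
Proof.
rewrite curvE !sum3 !mxE /= /w2 (dw o2 i j sa2) (dE2 i j Vy) /w0 /w1.
by move: (partial _ _ _) (partial _ _ _) => p q; ring.
Qed.

Let curv12 i j : curv W i j y o1 o2 =
  (partial i a0 y * E y o0 j - partial j a0 y * E y o0 i) +
  (a0 y - a1 y * a2 y) * (E y o1 i * E y o2 j - E y o1 j * E y o2 i).
Proof.
rewrite curvE !sum3 !mxE /= /w0 (dw o0 i j sa0) (dE0 i j Vy) /w2 /w1.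
by move: (partial _ _ _) (partial _ _ _) => p q; ring.
Qed.

Let curv20 i j : curv W i j y o2 o0 =
  (partial i a1 y * E y o1 j - partial j a1 y * E y o1 i) +
  (- a1 y - a2 y * a0 y) * (E y o2 i * E y o0 j - E y o2 j * E y o0 i).
Proof.
rewrite curvE !sum3 !mxE /= /w1 (dw o1 i j sa1) (dE1 i j Vy) /w2 /w0.
by move: (partial _ _ _) (partial _ _ _) => p q; ring.
Qed.

Let curv_antisym i j A B : curv W i j y B A = - curv W i j y A B.
Proof.
rewrite !curvE; move: A B.
by apply: ord3_ind; apply: ord3_ind; rewrite !sum3 !mxE /=; ring.
Qed.

Let T A B := contract A B (fun a d => curv W a d y A B).

Let T_sym A B : T A B = T B A.
Proof.
rewrite /T /contract exchange_big; apply: eq_bigr => a _; apply: eq_bigr => d _.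
rewrite (curv_antisym a d A B) (curv_anti W d a y).
have -> : (- curv W d a y) A B = - curv W d a y A B by rewrite mxE.
by rewrite opprK; ring.
Qed.

Let T_diag A : T A A = 0.
Proof.
have H i j : curv W i j y A A = 0.
  by have := curv_antisym i j A A; lra.
rewrite /T /contract big1 // => a _; rewrite big1 // => d _.
by rewrite H mulr0.
Qed.

(** The form [e_C] kills the frame vectors [A] and [B], so the derivatives [p] disappear, while
    [e_A /\ e_B] takes the value 1 on them. *)
Let T_wedge A B C (p : 'I_3 -> R) c : C != A -> C != B -> A != B ->
  contract A B (fun i j => (p i * E y C j - p j * E y C i) +
     c * (E y A i * E y B j - E y A j * E y B i)) = c.
Proof.
move=> CA CB AB.
rewrite contractD contractZ (contract_wedge A B p (E y C)).
rewrite (contract_wedge A B (E y A) (E y B)) !dual !eqxx [B == A]eq_sym.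
by rewrite (negbTE CA) (negbTE CB) (negbTE AB) /=; ring.
Qed.

Lemma unimodular_scalar :
  coord_ricci_scalar (fun z => (E z)^T *m E z) y = - (1 / 2) * k y ^+ 2 - 2.
Proof.
rewrite (frame_scalar oV sE uE sW antiW torsion Vy).
(* What remains is twice the sum of the three sectional curvatures. *)
rewrite [LHS](_ : _ = \sum_A \sum_B T A B) // !sum3 !T_diag.
rewrite (T_sym o1 o0) (T_sym o2 o1) (T_sym o0 o2).
have -> : T o0 o1 = a2 y * k y - a0 y * a1 y.
  rewrite /T -[RHS](@T_wedge o0 o1 o2 (fun i => partial i a2 y)) //.
  by rewrite /contract; apply: eq_bigr => i _; apply: eq_bigr => j _; rewrite curv01.
have -> : T o1 o2 = a0 y - a1 y * a2 y.
  rewrite /T -[RHS](@T_wedge o1 o2 o0 (fun i => partial i a0 y)) //.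
  by rewrite /contract; apply: eq_bigr => i _; apply: eq_bigr => j _; rewrite curv12.
have -> : T o2 o0 = - a1 y - a2 y * a0 y.
  rewrite /T -[RHS](@T_wedge o2 o0 o1 (fun i => partial i a1 y)) //.
  by rewrite /contract; apply: eq_bigr => i _; apply: eq_bigr => j _; rewrite curv20.
by rewrite /a0 /a1 /a2; field.
Qed.

End AtPoint.

End Unimodular.

(** * Structure equations of the frame bundle *)

Lemma smooth_curv (R : realType) n (U : set 'rV[R]_n) p
    (Gam : 'I_n -> 'rV[R]_n -> 'M[R]_p) i j : open U ->
  (forall i, smooth_mx U (Gam i)) -> smooth_mx U (curv Gam i j).
Proof.
move=> oU sG; have sM k l := smooth_mxM oU (sG k) (sG l).
apply: smooth_mxD => //; apply: smooth_mxB => //; exact: smooth_dmx.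
Qed.

(** Values in the line spanned by [L] commute, so the quadratic part of the curvature vanishes. *)
Lemma curv_abelian (R : realType) n (U : set 'rV[R]_n) p (f : 'I_n -> 'rV[R]_n -> R)
    (L : 'M[R]_p) i j x : open U -> U x -> (forall i, smooth_on U (f i)) ->
  curv (fun i z => f i z *: L) i j x = (partial i (f j) x - partial j (f i) x) *: L.
Proof.
move=> oU Ux sf; have D k l : dmx k (fun z => f l z *: L) x = partial k (f l) x *: L.
  by rewrite (dmxZ k Ux (sf l) (smooth_mx_cst oU L)) dmx_cst scaler0 addr0.
rewrite /curv (D i j) (D j i) -!scalemxAl -!scalemxAr !scalerA.
by rewrite [f j x * _]mulrC subrr addr0 scalerBl.
Qed.

Lemma sum2_anti (R : comNzRingType) (V : lmodType R) (a b : 'I_2 -> R)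
    (F : 'I_2 -> 'I_2 -> V) : (forall c d, F d c = - F c d) -> (forall c, F c c = 0) ->
  \sum_c \sum_d (a c * b d) *: F c d = (a 0 * b 1 - a 1 * b 0) *: F 0 1.
Proof.
move=> aF F0; rewrite !sum2 !F0 (aF 0 1) !scaler0 add0r addr0 scalerN.
by rewrite -scalerBl.
Qed.

(** * The Lie algebra so(1,1) *)

Section Minkowski.
Variable R : realType.

Definition boost_gen : 'M[R]_2 := \matrix_(i, j) (i != j)%:R.

Lemma minkowskiK : minkowski R *m minkowski R = 1%:M.
Proof.
by apply/matrixP; apply: ord2_ind; apply: ord2_ind; rewrite !mxE sum2 !mxE /=; ring.
Qed.

Lemma minkowski_unit : minkowski R \in unitmx.
Proof. by case/mulmx1_unit: minkowskiK. Qed.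

Lemma so11P (B : 'M[R]_2) :
  minkowski R *m B + (minkowski R *m B)^T = 0 -> B = B 0 1 *: boost_gen.
Proof.
move=> /matrixP H.
have := H 0 0; have := H 0 1; have := H 1 1.
rewrite !mxE !sum2 !mxE /= => H11 H01 H00.
apply/matrixP; apply: ord2_ind; apply: ord2_ind; rewrite !mxE /=; lra.
Qed.

Lemma boost_multiple (B : 'M[R]_2) c : B = c *: boost_gen -> B = B 0 1 *: boost_gen.
Proof. by move=> ->; rewrite !mxE /= mulr1. Qed.

Lemma boost_coord c : (c *: boost_gen) 0 1 = c.
Proof. by rewrite !mxE /= mulr1. Qed.

Lemma det2 (A : 'M[R]_2) : \det A = A 0 0 * A 1 1 - A 0 1 * A 1 0.
Proof.
rewrite (expand_det_row _ 0) sum2 /cofactor !det_mx11 !mxE /=.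
rewrite (_ : lift 0 0 = 1); last by apply: val_inj.
rewrite (_ : lift 1 0 = 0); last by apply: val_inj.
rewrite /= /bump /=; ring.
Qed.

Lemma boost_mul0 m (c : R) (T : 'M[R]_(2, m)) j :
  (c *: boost_gen *m T) 0 j = c * T 1 j.
Proof. by rewrite mxE sum2 !mxE /=; ring. Qed.

Lemma boost_mul1 m (c : R) (T : 'M[R]_(2, m)) j :
  (c *: boost_gen *m T) 1 j = c * T 0 j.
Proof. by rewrite mxE sum2 !mxE /=; ring. Qed.

(** [boost_gen *m minkowski] is the standard antisymmetric matrix, which the congruence by [b]
    multiplies by [\det b]. The entries (0,1) and (1,0) contribute equally, whence the factor 2. *)
Lemma boost_trace (b G : 'M[R]_2) (C : 'I_2 -> 'I_2 -> 'M[R]_2) c :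
  (forall d, C d d = 0) -> C 1 0 = - C 0 1 ->
  C 0 1 *m G = c *: (b *m boost_gen *m minkowski R *m b^T) ->
  \sum_a \sum_d (C a d *m G) a d = 2 * (\det b * c).
Proof.
move=> C0 C1 CG; rewrite !sum2 !C0 C1 !mul0mx mulNmx CG det2.
rewrite !mxE !sum2 !mxE !sum2 !mxE !sum2 !mxE /=; ring.
Qed.

End Minkowski.

Section FrameBundle.
Variables (R : realType) (U : set 'rV[R]_2) (g : 'rV[R]_2 -> 'M[R]_2).
Hypotheses (oU : open U) (sg : smooth_mx U g)
  (gS : forall x, U x -> (g x)^T = g x) (gU : forall x, U x -> g x \in unitmx).
Variables (V : set 'rV[R]_3) (x : 'rV[R]_3 -> 'rV[R]_2) (beta : 'rV[R]_3 -> 'M[R]_2).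
Hypotheses (oV : open V) (VU : forall y, V y -> U (x y))
  (sx : forall a, smooth_on V (fun y => x y 0 a)) (sb : smooth_mx V beta)
  (ortho : forall y, V y -> (beta y)^T *m g (x y) *m beta y = minkowski R).

Let t i y : 'rV[R]_2 * 'M[R]_2 :=
  (\row_a partial i (fun z => x z 0 a) y, dmx i beta y).

Hypothesis immersion : forall y, V y -> forall v : 'rV[R]_3,
  \sum_(i < 3) v 0 i *: (t i y).1 = 0 ->
  \sum_(i < 3) v 0 i *: (t i y).2 = 0 -> v = 0.

Let ub y : V y -> beta y \in unitmx.
Proof.
move=> Vy; have := @minkowski_unit R.
by rewrite -(ortho Vy) unitmx_mul => /andP[].
Qed.

Let Gam := christoffel_mx g.
Let sGam d : smooth_mx U (Gam d). Proof. exact: smooth_christoffel. Qed.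
Let A := pullback x Gam.
Let sA i : smooth_mx V (A i). Proof. exact: (smooth_pullback oV VU sx sGam). Qed.
Let varpi := gauge beta A.
Let svarpi i : smooth_mx V (varpi i). Proof. exact: smooth_gauge. Qed.
Let omega i y := varpi i y 0 1.
Let X y : 'M[R]_(2, 3) := \matrix_(a, i) partial i (fun z => x z 0 a) y.
Let sX : smooth_mx V X.
Proof. by move=> a i; under eq_fun do rewrite mxE; exact: smooth_partial. Qed.
Let Theta y := invmx (beta y) *m X y.
Let sTheta : smooth_mx V Theta.
Proof. by apply: smooth_mxM => //; exact: smooth_invmx. Qed.

(** Orthonormality of [beta] is differentiated along [V]. With the derivative of [g] expressed by
    metric compatibility, the result is the infinitesimal Lorentz condition of [so11P]. *)
Let varpi_so11 i y : V y -> varpi i y = omega i y *: @boost_gen R.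
Proof.
move=> Vy; apply: so11P.
have Eq : (beta y)^T *m g (x y) = minkowski R *m invmx (beta y).
  by rewrite -(ortho Vy) mulmxK ?ub.
have -> : minkowski R *m varpi i y =
    (beta y)^T *m g (x y) *m (dmx i beta y + A i y *m beta y).
  by rewrite /varpi /gauge mulmxA -Eq.
have H : dmx i (fun z => (beta z)^T *m g (x z) *m beta z) y = 0.
  by rewrite (eq_on_dmx oV i Vy (B := fun=> minkowski R)) ?dmx_cst.
have sgx : smooth_mx V (fun z => g (x z)) by exact: (smooth_mx_comp oV VU sx).
have sbt := smooth_mx_tr sb.
rewrite (dmxM i Vy (smooth_mxM oV sbt sgx) sb) (dmxM i Vy sbt sgx) dmx_tr in H.
have gA : dmx i (fun z => g (x z)) y = g (x y) *m A i y + (g (x y) *m A i y)^T.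
  rewrite (dmx_comp VU sx i Vy sg) /A /pullback mulmx_sumr linear_sum -big_split /=.
  apply: eq_bigr => d _; rewrite (christoffel_metric oU gS gU d (VU Vy)).
  by rewrite -scalemxAr linearZ -scalerDr.
rewrite gA in H; rewrite -[RHS]H.
rewrite !mulmxDr !mulmxDl !trmx_mul linearD /= !trmx_mul !trmxK (gS (VU Vy)) !mulmxA.
move: ((beta y)^T *m g (x y) *m dmx i beta y) => a.
move: ((beta y)^T *m g (x y) *m A i y *m beta y) => b.
move: ((dmx i beta y)^T *m g (x y) *m beta y) => c.
move: ((beta y)^T *m (A i y)^T *m g (x y) *m beta y) => d.
by apply/matrixP => u v; rewrite !mxE; ring.
Qed.

Let A_sym i j y c : V y -> (A i y *m X y) c j = (A j y *m X y) c i.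
Proof.
move=> Vy.
have H k l : (A k y *m X y) c l = \sum_e \sum_d
    X y d k * X y e l * Gam d (x y) c e.
  rewrite mxE; apply: eq_bigr => e _; rewrite /A /pullback summxE mulr_suml.
  by apply: eq_bigr => d _; rewrite mxE [X y d k]mxE; ring.
apply: etrans (H i j) (etrans _ (esym (H j i))).
rewrite exchange_big; apply: eq_bigr => e _; apply: eq_bigr => d _.
by rewrite /Gam (christoffel_mx_sym oU gS e d c (VU Vy)); ring.
Qed.

(** Cartan's first equation. The derivative of [invmx beta] cancels the [dbeta] part of [varpi];
    what remains is symmetric in [i], [j] by [partialC] and by the torsion-freeness [A_sym] of the
    base connection. *)
Let torsionTheta i j y a : V y ->
  dmx i Theta y a j + (varpi i y *m Theta y) a j =
  dmx j Theta y a i + (varpi j y *m Theta y) a i.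
Proof.
move=> Vy.
have H k : dmx k Theta y + varpi k y *m Theta y =
    invmx (beta y) *m (dmx k X y + A k y *m X y).
  rewrite /Theta (dmxM k Vy (smooth_invmx oV ub sb) sX) (dmxV oV k Vy ub sb).
  rewrite /varpi /gauge; set Q := invmx _.
  have -> : Q *m (dmx k beta y + A k y *m beta y) *m (Q *m X y) =
     Q *m dmx k beta y *m Q *m X y + Q *m (A k y *m X y).
    by rewrite mulmxDr mulmxDl !mulmxA mulmxK ?ub.
  by rewrite mulNmx addrAC addrA addNr add0r mulmxDr addrC.
have E k l : dmx k Theta y a l + (varpi k y *m Theta y) a l =
    \sum_c invmx (beta y) a c * (dmx k X y c l + (A k y *m X y) c l).
  have /matrixP /(_ a l) := H k; rewrite [LHS]mxE => ->.
  by rewrite mxE; apply: eq_bigr => c _; congr (_ * _); rewrite mxE.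
have P c k l : dmx k X y c l = partial k (partial l (fun z => x z 0 c)) y.
  by rewrite mxE; congr (partial k _ y); apply/funext => z; rewrite mxE.
rewrite (E i j) (E j i); apply: eq_bigr => c _.
congr (_ * (_ + _)); last exact: A_sym.
exact: etrans (P c i j) (etrans (partialC i j oV Vy (sx c)) (esym (P c j i))).
Qed.

Let N y := invmx (beta y) *m curv Gam 0 1 (x y) *m beta y.

(** On a surface only the curvature component 0 1 matters, and the pullback of [dx^0 /\ dx^1] is
    [\det beta] times [theta^0 /\ theta^1]. *)
Let curv_varpi i j y : V y -> curv varpi i j y =
  (\det (beta y) * (Theta y 0 i * Theta y 1 j - Theta y 0 j * Theta y 1 i)) *: N y.
Proof.
move=> Vy; rewrite /varpi (curv_gauge oV ub sb sA i j Vy).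
rewrite /A (curv_pullback oV VU sx sGam i j Vy) sum2_anti; first last.
- by move=> d; rewrite /curv subrr add0r subrr.
- by move=> c d; exact: curv_anti.
rewrite -scalemxAr -scalemxAl; congr (_ *: _).
have XT c l : partial l (fun z => x z 0 c) y =
    beta y c 0 * Theta y 0 l + beta y c 1 * Theta y 1 l.
  have : X y c l = (beta y *m Theta y) c l by rewrite mulKVmx ?ub.
  by rewrite [LHS]mxE => ->; rewrite mxE sum2.
by rewrite !XT det2; ring.
Qed.

Let curv_omega i j y : V y -> curv varpi i j y =
  (partial i (omega j) y - partial j (omega i) y) *: @boost_gen R.
Proof.
move=> Vy.
have so k : smooth_on V (omega k) by exact: (svarpi k).
rewrite (eq_on_curv oV i j Vy (fun k z Vz => varpi_so11 k Vz)).
exact: (curv_abelian (@boost_gen R) i j oV Vy so).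
Qed.

Let E y : 'M[R]_3 :=
  \matrix_(a, i) nth 0 [:: Theta y 0 i; Theta y 1 i; omega i y] a.

Let sE : smooth_mx V E.
Proof.
apply: ord3_ind => i; under eq_fun do rewrite mxE /=.
- exact: sTheta.
- exact: sTheta.
- exact: svarpi.
Qed.

(** A kernel vector [v] has [dx(v) = 0] since [beta] is invertible, so the Christoffel part of
    [varpi(v)] vanishes. As [varpi(v)] vanishes with its coordinate [omega(v)], also [dbeta(v) = 0],
    and the immersion property gives [v = 0]. *)
Let uE y : V y -> E y \in unitmx.
Proof.
move=> Vy; rewrite -unitmx_tr unitmxE unitfE; apply/det0P => -[v v0 vE].
have Ev a : \sum_i v 0 i * E y a i = 0.
  transitivity ((v *m (E y)^T) 0 a); last by rewrite vE mxE.
  by rewrite [RHS]mxE; apply: eq_bigr => i _; rewrite [_^T _ _]mxE.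
have ThetaV : Theta y *m v^T = 0.
  apply/matrixP => a b; rewrite ord1 [LHS]mxE [RHS]mxE; move: a; apply: ord2_ind.
    apply: etrans _ (Ev o0); apply: eq_bigr => i _.
    by rewrite [v^T _ _]mxE [E _ _ _]mxE mulrC.
  apply: etrans _ (Ev o1); apply: eq_bigr => i _.
  by rewrite [v^T _ _]mxE [E _ _ _]mxE mulrC.
have XV : X y *m v^T = 0.
  by rewrite -[X y](mulKVmx (ub Vy)) -mulmxA -/(Theta y) ThetaV mulmx0.
have Xi c : \sum_i v 0 i * partial i (fun z => x z 0 c) y = 0.
  transitivity ((X y *m v^T) c 0); last by rewrite XV mxE.
  rewrite [RHS]mxE; apply: eq_bigr => i _.
  by rewrite [X _ _ _]mxE [v^T _ _]mxE mulrC.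
have AV : \sum_i v 0 i *: A i y = 0.
  under eq_bigr do rewrite /A /pullback scaler_sumr.
  rewrite exchange_big big1 // => d _; under eq_bigr do rewrite scalerA.
  by rewrite -scaler_suml Xi scale0r.
case/negP: v0; apply/eqP; apply: (immersion Vy).
  by apply/rowP => c; rewrite summxE mxE -[RHS](Xi c); apply: eq_bigr => i _; rewrite !mxE.
have varpiV : \sum_i v 0 i *: varpi i y = 0.
  under eq_bigr do rewrite varpi_so11 // scalerA.
  rewrite -scaler_suml -[X in X *: _](_ : \sum_i v 0 i * E y o2 i = _).
    by rewrite Ev scale0r.
  by apply: eq_bigr => i _; rewrite mxE.
have : \sum_i v 0 i *: (beta y *m varpi i y) = 0.
  under eq_bigr do rewrite scalemxAr.
  by rewrite -mulmx_sumr varpiV mulmx0.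
under eq_bigr do rewrite /varpi /gauge mulKVmx ?ub // scalerDr scalemxAl.
by rewrite big_split /= -mulmx_suml AV mul0mx addr0.
Qed.

Let k y := \det (beta y) * N y 0 1.

Let sk : smooth_on V k.
Proof.
have sN : smooth_mx V N.
  apply: smooth_mxM => //; apply: smooth_mxM => //; first exact: smooth_invmx.
  exact: (smooth_mx_comp oV VU sx (smooth_curv 0 1 oU sGam)).
by apply: smoothM => //; exact: smooth_det.
Qed.

(** Otherwise [e0 /\ e1] would be zero, but it takes the value 1 on the first two vectors of the
    dual frame. *)
Let wedge_neq0 y : V y ->
  exists i j, Theta y 0 i * Theta y 1 j - Theta y 0 j * Theta y 1 i != 0.
Proof.
move=> Vy; apply: contrapT => H.
have E0 l : E y o0 l = Theta y 0 l by rewrite [LHS]mxE.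
have E1 l : E y o1 l = Theta y 1 l by rewrite [LHS]mxE.
have m0 i j : E y o0 i * E y o1 j - E y o0 j * E y o1 i = 0.
  rewrite (E0 i) (E0 j) (E1 i) (E1 j).
  by apply/eqP; apply: contrapT => /negP h; apply: H; exists i, j.
have D a b : \sum_i E y a i * invmx (E y) i b = (a == b)%:R.
  by have := mulmxV (uE Vy) => /matrixP /(_ a b); rewrite !mxE.
have := wedge_sum (E y o0) (E y o1) (invmx (E y) ^~ o0) (invmx (E y) ^~ o1).
rewrite !D big1 => [|i _]; last by rewrite big1 // => j _; rewrite m0 mulr0.
by rewrite /= mulr1 mulr0 subr0 => /eqP; rewrite oner_eq0.
Qed.

(** The two expressions for [curv varpi] are compared at indices where [theta^0 /\ theta^1] is
    nonzero, and the factor in front of [N] is divided out. *)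
Let N_so11 y : V y -> N y = N y 0 1 *: @boost_gen R.
Proof.
move=> Vy; have [i [j m0]] := wedge_neq0 Vy.
have := curv_omega i j Vy; rewrite (curv_varpi i j Vy).
set m := \det _ * _ => H.
have mn0 : m != 0.
  by rewrite mulf_neq0 // -unitfE -unitmxE ub.
have {H}H : N y = (m^-1 * (partial i (omega j) y - partial j (omega i) y)) *: @boost_gen R.
  by rewrite -scalerA -H scalerA mulVf // scale1r.
exact: boost_multiple H.
Qed.

(** Orthonormality makes the inverse metric [beta *m minkowski *m beta^T], which brings the
    curvature into the form required by [boost_trace]. *)
Let base_scalar y : V y -> coord_ricci_scalar g (x y) = 2 * k y.
Proof.
move=> Vy; rewrite ricci_scalarE -/Gam.
have C0 d : curv Gam d d (x y) = 0 by rewrite /curv subrr add0r subrr.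
have C1 : curv Gam 1 0 (x y) = - curv Gam 0 1 (x y) by exact: curv_anti.
have ginv : invmx (g (x y)) = beta y *m minkowski R *m (beta y)^T.
  apply: (can_inj (mulKmx (gU (VU Vy)))).
  rewrite mulmxV ?gU //; last exact: VU.
  apply: (can_inj (mulKmx (_ : (beta y)^T \in unitmx))); first by rewrite unitmx_tr ub.
  rewrite mulmx1 !mulmxA (ortho Vy) minkowskiK mul1mx //.
have RN : curv Gam 0 1 (x y) *m beta y = beta y *m N y.
  by rewrite /N !mulmxA mulmxV ?ub // mul1mx.
have RG : curv Gam 0 1 (x y) *m invmx (g (x y)) =
    N y 0 1 *: (beta y *m @boost_gen R *m minkowski R *m (beta y)^T).
  rewrite ginv !mulmxA RN {1}(N_so11 Vy) -scalemxAr -!scalemxAl //.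
exact: boost_trace C0 C1 RG.
Qed.

Let dE i j y a b : V y -> (forall z l, E z a l = Theta z b l) ->
  dmx i E y a j - dmx j E y a i =
  - (varpi i y *m Theta y) b j + (varpi j y *m Theta y) b i.
Proof.
move=> Vy H.
have P k' l : dmx k' E y a l = dmx k' Theta y b l.
  by rewrite !mxE; congr (partial k' _ y); apply/funext => z; rewrite H.
apply: etrans (congr2 (fun u v => u - v) (P i j) (P j i)) _.
have alg (p q r s : R) : p + r = q + s -> p - q = - r + s by move=> ?; lra.
by apply: alg; exact: torsionTheta.
Qed.

Lemma schmidt_scalar y : V y ->
  coord_ricci_scalar (fun y => \matrix_(i, j) schmidt_form g (x y) (beta y) (t i y) (t j y)) y
  = - (1 / 8) * coord_ricci_scalar g (x y) ^+ 2 - 2.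
Proof.
move=> Vy.
have conn i z : connection g (x z) (beta z) (t i z).1 (t i z).2 = varpi i z.
  apply/matrixP => a b; rewrite mxE [RHS]mxE; apply: eq_bigr => c _.
  congr (_ * _); rewrite [RHS]mxE; congr (_ + _).
  rewrite [RHS]mxE exchange_big; apply: eq_bigr => e _ /=.
  rewrite /A /pullback summxE mulr_suml; apply: eq_bigr => d _.
  by rewrite !mxE; ring.
have sold i z a : solder (beta z) (t i z).1 a 0 = Theta z a i.
  by rewrite !mxE; apply: eq_bigr => c _; rewrite !mxE.
have -> : (fun y => \matrix_(i, j) schmidt_form g (x y) (beta y) (t i y) (t j y)) =
    (fun z => (E z)^T *m E z).
  apply/funext => z; apply/matrixP => i j.
  by rewrite !mxE /schmidt_form !conn sum2 !sold sum3 !mxE.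
have T0 i j z : V z -> (varpi i z *m Theta z) 0 j = omega i z * Theta z 1 j.
  by move=> Vz; rewrite (varpi_so11 i Vz); exact: boost_mul0.
have T1 i j z : V z -> (varpi i z *m Theta z) 1 j = omega i z * Theta z 0 j.
  by move=> Vz; rewrite (varpi_so11 i Vz); exact: boost_mul1.
have E0 z l : E z o0 l = Theta z 0 l by rewrite [LHS]mxE.
have E1 z l : E z o1 l = Theta z 1 l by rewrite [LHS]mxE.
have E2 z l : E z o2 l = omega l z by rewrite [LHS]mxE.
have wedgeE (a b c d a' b' c' d' : R) : a = a' -> b = b' -> c = c' -> d = d' ->
  a * b - c * d = a' * b' - c' * d' by move=> -> -> -> ->.
rewrite (unimodular_scalar oV sE uE sk) //.
(* Since [k] is half the scalar curvature of the base, the factor 1/2 in front of [k ^+ 2] becomes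
   1/8. *)
- by rewrite base_scalar //; field.
- move=> i j z Vz; apply: etrans (dE i j Vz E0) _.
  apply: etrans (congr2 (fun u v => - u + v) (T0 i j z Vz) (T0 j i z Vz)) _.
  apply: etrans _ (esym (wedgeE _ _ _ _ _ _ _ _ (E1 z i) (E2 z j) (E1 z j) (E2 z i))).
  have alg (wi wj ti tj : R) : - (wi * tj) + wj * ti = ti * wj - tj * wi by ring.
  exact: alg.
- move=> i j z Vz; apply: etrans (dE i j Vz E1) _.
  apply: etrans (congr2 (fun u v => - u + v) (T1 i j z Vz) (T1 j i z Vz)) _.
  apply: etrans _ (esym (congr1 -%R
    (wedgeE _ _ _ _ _ _ _ _ (E2 z i) (E0 z j) (E2 z j) (E0 z i)))).
  have alg (wi wj ti tj : R) : - (wi * tj) + wj * ti = - (wi * tj - wj * ti) by ring.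
  exact: alg.
- move=> i j z Vz.
  have P k' l : dmx k' E z o2 l = partial k' (omega l) z.
    by rewrite mxE; congr (partial k' _ z); apply/funext => z'; rewrite E2.
  apply: etrans (congr2 (fun u v => u - v) (P i j) (P j i)) _.
  apply: etrans (esym (boost_coord _)) _.
  apply: etrans (congr1 (fun A : 'M[R]_2 => A 0 1)
    (etrans (esym (curv_omega i j Vz)) (curv_varpi i j Vz))) _.
  apply: etrans _ (esym (congr1 (fun u => k z * u)
    (wedgeE _ _ _ _ _ _ _ _ (E0 z i) (E1 z j) (E0 z j) (E1 z i)))).
  rewrite mxE /k.
  have alg (d m n : R) : d * m * n = d * n * m by ring.
  exact: alg.
Qed.

End FrameBundle.

(** * Charts and frames of a Lorentzian surface *)

Lemma smooth_on_subset (R : realType) n (U V : set 'rV[R]_n) f :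
  V `<=` U -> smooth_on U f -> smooth_on V f.
Proof. by move=> VU sf s x /VU; exact: sf. Qed.

Lemma smooth_mx_subset (R : realType) n (U V : set 'rV[R]_n) p q
    (A : 'rV[R]_n -> 'M[R]_(p, q)) :
  V `<=` U -> smooth_mx U A -> smooth_mx V A.
Proof. by move=> VU sA a b; exact: smooth_on_subset (sA a b). Qed.

Lemma lorentzian_form_unit (R : realType) (A : 'M[R]_2) :
  lorentzian_form A -> A \in unitmx.
Proof.
move=> [_ [P _ PA]]; have := @minkowski_unit R.
by rewrite -PA !unitmx_mul => /andP[/andP[]].
Qed.

Section Charts.
Variables (R : realType) (n : nat) (M : topologicalType).
Implicit Types c : chart R n M.

Lemma transition_coord c c' p : chart_dom c p -> transition c c' (coord c p) = coord c' p.
Proof. by move=> cp; rewrite /transition coordK. Qed.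

Lemma overlap_open c c' : open (overlap c c').
Proof.
have cc : {in chart_cod c, continuous (coord_inv c)}.
  rewrite -continuous_open_subspace; first exact: coord_inv_continuous.
  exact: chart_cod_open.
rewrite openE => z [p [cp c'p] <-]; rewrite /interior.
have codp : chart_cod c (coord c p) by exists p.
have N1 : nbhs (coord c p) (chart_cod c).
  by apply: open_nbhs_nbhs; split => //; exact: chart_cod_open.
have N2 : nbhs (coord c p) (coord_inv c @^-1` chart_dom c').
  apply: (cc _ (mem_set codp)); rewrite coordK //.
  by apply: open_nbhs_nbhs; split => //; exact: chart_dom_open.
apply: filterS2 N1 N2 => _ [q cq <-] /=; rewrite coordK // => c'q.
by exists q.
Qed.

Lemma jac_id c z : chart_cod c z -> jac c c z = 1%:M.
Proof.
move=> cz; apply/matrixP => a b; rewrite !mxE eq_sym -(partial_coord b a z).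
apply: (eq_on_partial _ (@chart_cod_open R n M c) cz) => _ [q cq <-].
by rewrite transition_coord.
Qed.

End Charts.

Section Atlas.
Variables (R : realType) (n : nat) (M : oriented_manifold R n).

Lemma atlas_chart_at (p : M) : atlas (chart_at p).
Proof. by case: (svalP (cid (atlas_cover p))). Qed.

Lemma chart_at_dom (p : M) : chart_dom (chart_at p) p.
Proof. by case: (svalP (cid (atlas_cover p))). Qed.

Lemma jac_cocycle (c c' : chart R n M) p : atlas c -> atlas c' ->
  chart_dom c p -> chart_dom c' p ->
  jac c' c (coord c' p) *m jac c c' (coord c p) = 1%:M.
Proof.
move=> ac ac' cp c'p.
have Oz : overlap c c' (coord c p) by exists p.
have Oz' : overlap c' c (coord c' p) by exists p.
apply/matrixP => a b; rewrite mxE.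
transitivity (partial b (fun z => transition c' c (transition c c' z) 0 a) (coord c p)).
  rewrite (@partial_comp _ _ _ (fun w => transition c' c w 0 a)).
  - by apply: eq_bigr => e _; rewrite !mxE transition_coord.
  - by move=> e; exact: smooth_differentiable (atlas_smooth ac ac' e) Oz.
  - rewrite transition_coord //.
    exact: smooth_differentiable (atlas_smooth ac' ac a) Oz'.
rewrite [RHS]mxE eq_sym -(partial_coord b a (coord c p)).
apply: (eq_on_partial _ (@overlap_open R n M c c') Oz) => _ [q [cq c'q] <-].
by rewrite !transition_coord.
Qed.

End Atlas.

Section LorentzianSurface.
Variables (R : realType) (M : lorentzian_surface R).
Implicit Types (c : chart R 2 M) (u w : orthonormal_frame M).

Lemma metric_mx_sym c z : atlas c -> chart_cod c z -> (metric c z)^T = metric c z.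
Proof. by move=> ac cz; have [] := metric_lorentzian ac cz. Qed.

Lemma metric_mx_unit c z : atlas c -> chart_cod c z -> metric c z \in unitmx.
Proof. by move=> ac cz; exact: lorentzian_form_unit (metric_lorentzian ac cz). Qed.

Lemma frame_comp_orthonormal c u : atlas c -> chart_dom c (frame_pt u) ->
  (frame_comp c u)^T *m metric c (coord c (frame_pt u)) *m frame_comp c u =
  minkowski R.
Proof.
move=> ac cu; have /= := frame_orthonormal u.
rewrite (metric_tensor (atlas_chart_at _) ac (chart_at_dom _) cu) => <-.
by rewrite /frame_comp trmx_mul !mulmxA.
Qed.

Lemma local_schmidt_scalar c psi V y : atlas c ->
  local_parametrization c psi V -> V y ->
  coord_ricci_scalar (schmidt_metric c psi) y =
  - (1 / 8) * coord_ricci_scalar (metric c) (coord c (frame_pt (psi y))) ^+ 2 - 2.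
Proof.
move=> ac [oV dV sx sb _ im] Vy.
apply: (@schmidt_scalar R (chart_cod c) (metric c) _ _ _ _ V
  (base_coord c psi) (fibre_coord c psi)) => //.
- exact: chart_cod_open.
- by move=> a b; exact: metric_smooth.
- by move=> z; exact: metric_mx_sym.
- by move=> z; exact: metric_mx_unit.
- by move=> z Vz; exists (frame_pt (psi z)) => //; exact: dV.
- by move=> z Vz; apply: frame_comp_orthonormal => //; exact: dV.
Qed.

(** A frame at [p] is stored in [chart_at p], which may jump as [p] moves. Components in a fixed
    chart [c] are therefore carried over by the Jacobian, whose positive determinant preserves the
    orientation. *)
Lemma frame_exists c p (b : 'M[R]_2) : atlas c -> chart_dom c p ->
  b^T *m metric c (coord c p) *m b = minkowski R -> 0 < \det b ->
  ((time_field c (coord c p))^T *m metric c (coord c p) *m col 0 b) 0 0 < 0 ->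
  exists w, frame_pt w = p /\ frame_comp c w = b.
Proof.
move=> ac cp bo bd bf.
pose c0 := chart_at p; pose J := jac c c0 (coord c p).
have ac0 : atlas c0 by exact: atlas_chart_at.
have c0p : chart_dom c0 p by exact: chart_at_dom.
rewrite (metric_tensor ac ac0 cp c0p) -/J in bo bf.
have wo : (J *m b)^T *m metric c0 (coord c0 p) *m (J *m b) = minkowski R.
  by rewrite -bo trmx_mul !mulmxA.
have wd : 0 < \det (J *m b).
  by rewrite det_mulmx mulr_gt0 //; apply: atlas_oriented => //; exists p.
have wf : ((time_field c0 (coord c0 p))^T *m metric c0 (coord c0 p)
    *m col 0 (J *m b)) 0 0 < 0.
  move: bf; rewrite (time_field_tensor ac ac0 cp c0p) -/J !colE trmx_mul.
  by rewrite !mulmxA.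
exists (@OrthonormalFrame R M p (J *m b) wo wd wf); split => //.
by rewrite /frame_comp /= mulmxA jac_cocycle // mul1mx.
Qed.

Lemma frame_comp_inj c u w : atlas c -> chart_dom c (frame_pt u) ->
  frame_pt w = frame_pt u -> frame_comp c w = frame_comp c u -> w = u.
Proof.
case: u => p m o d f; case: w => p' m' o' d' f' /= ac cp pp; subst p'.
rewrite /frame_comp /= => /(congr1 (mulmx (jac c (chart_at p) (coord c p)))).
rewrite !mulmxA jac_cocycle //; [|exact: atlas_chart_at|exact: chart_at_dom].
rewrite !mul1mx => mm; subst m'.
by congr OrthonormalFrame; exact: Prop_irrelevance.
Qed.

End LorentzianSurface.

(** * Gram-Schmidt and boosts in signature (-,+) *)

Section GramSchmidt.
Variable R : realType.

(** For vectors [v0], [v1] with Gram matrix [h]: [p] normalizes the timelike [v0]; the vector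
    [h01 v0 - h00 v1] is orthogonal to it and has square [- h00 (h01^2 - h00 h11)], so [p q]
    normalizes it. *)
Definition gram_schmidt (h : 'M[R]_2) : 'M[R]_2 :=
  let p := (Num.sqrt (- h 0 0))^-1 in
  let q := (Num.sqrt (h 0 1 ^+ 2 - h 0 0 * h 1 1))^-1 in
  \matrix_(i, j) nth 0 (nth [::] [:: [:: p; h 0 1 * p * q]; [:: 0; - h 0 0 * p * q]] i) j.

(* The boost of rapidity [ln s]: this parameter makes the entries rational functions. *)
Definition boost (s : R) : 'M[R]_2 :=
  \matrix_(i, j) if i == j then (s + s^-1) / 2 else (s - s^-1) / 2.

Lemma gram_schmidt_ortho (h : 'M[R]_2) : h^T = h -> 0 < - h 0 0 ->
  0 < h 0 1 ^+ 2 - h 0 0 * h 1 1 ->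
  (gram_schmidt h)^T *m h *m gram_schmidt h = minkowski R.
Proof.
move=> hS a0 D0.
have h10 : h 1 0 = h 0 1 by rewrite -{1}hS mxE.
have pE : (Num.sqrt (- h 0 0))^-1 ^+ 2 * - h 0 0 = 1.
  by rewrite -[X in _ * X]sqr_sqrtr ?ltW // exprVn mulVf // expf_neq0 // gt_eqF // sqrtr_gt0.
have qE : (Num.sqrt (h 0 1 ^+ 2 - h 0 0 * h 1 1))^-1 ^+ 2 * (h 0 1 ^+ 2 - h 0 0 * h 1 1) = 1.
  by rewrite -[X in _ * X]sqr_sqrtr ?ltW // exprVn mulVf // expf_neq0 // gt_eqF // sqrtr_gt0.
have M (A H : 'M[R]_2) i j : (A^T *m H *m A) i j =
    (A 0 i * H 0 0 + A 1 i * H 1 0) * A 0 j + (A 0 i * H 0 1 + A 1 i * H 1 1) * A 1 j.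
  by rewrite !(mxE, sum2).
apply/matrixP => i j; rewrite M h10; move: i j pE qE.
apply: ord2_ind; apply: ord2_ind; rewrite !mxE /=;
  move: (Num.sqrt (- h 0 0))^-1 (Num.sqrt (h 0 1 ^+ 2 - h 0 0 * h 1 1))^-1 => p q;
  move: (h 0 0) (h 0 1) (h 1 1) => a b d pE qE.
- by transitivity (- (p ^+ 2 * - a)); [ring|rewrite pE].
- by ring.
- by ring.
- transitivity (p ^+ 2 * - a * (q ^+ 2 * (b ^+ 2 - a * d))); first by ring.
  by rewrite pE qE mulr1.
Qed.

Lemma gram_schmidt_minkowski : gram_schmidt (minkowski R) = 1%:M.
Proof.
apply/matrixP; apply: ord2_ind; apply: ord2_ind; rewrite !mxE /=;
  by rewrite ?opprK ?expr0n ?mulN1r ?mulr1 ?add0r ?opprK ?sqrtr1 ?invr1 ?mul0r ?mulr1.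
Qed.

Lemma boost1 : boost 1 = 1%:M.
Proof.
by apply/matrixP; apply: ord2_ind; apply: ord2_ind; rewrite !mxE /= invr1; field.
Qed.

Lemma boost_ortho s : s != 0 ->
  (boost s)^T *m (minkowski R) *m boost s = minkowski R.
Proof.
move=> s0; apply/matrixP; apply: ord2_ind; apply: ord2_ind;
  by rewrite !mxE !sum2 !mxE !sum2 !mxE /=; field.
Qed.

(** The null vector (1,1) is a common eigenvector of all boosts. Its eigenvalue recovers the
    parameter, which gives both injectivity and immersion in the fibre direction. *)
Lemma boost_row s : boost s *m (const_mx 1 : 'cV_2) = s *: const_mx 1.
Proof.
apply/matrixP => i j; move: i.
by apply: ord2_ind; rewrite !mxE sum2 !mxE /=; move: s^-1 => t; field.
Qed.

End GramSchmidt.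

Lemma smooth_col (R : realType) n (V : set 'rV[R]_n) p q (A : 'rV[R]_n -> 'M[R]_(p, q)) j :
  smooth_mx V A -> smooth_mx V (fun y => col j (A y)).
Proof. by move=> sA a b; under eq_fun do rewrite mxE; exact: sA. Qed.

(** * A local parametrization of [O(M)] through a given frame *)

Section Existence.
Variables (R : realType) (M : lorentzian_surface R) (u : orthonormal_frame M).

Let c := chart_at (frame_pt u).
Let ac : atlas c := atlas_chart_at (frame_pt u).
Let cu : chart_dom c (frame_pt u) := chart_at_dom (frame_pt u).
Let b0 := frame_comp c u.

Let x (y : 'rV[R]_3) : 'rV[R]_2 := \row_(a < 2) y 0 (lshift 1 a).

Let lift0 : lshift 1 (0 : 'I_2) = o0 :> 'I_3. Proof. exact: val_inj. Qed.
Let lift1 : lshift 1 (1 : 'I_2) = o1 :> 'I_3. Proof. exact: val_inj. Qed.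

Let V0 := x @^-1` chart_cod c.

Let sx V a : open V -> smooth_on V (fun y => x y 0 a).
Proof. by move=> oV; under eq_fun do rewrite mxE; exact: smooth_coord. Qed.

Let oV0 : open V0.
Proof.
apply: open_comp; last exact: chart_cod_open.
move=> y _; apply: differentiable_continuous; apply: differentiable_rV => a.
exact: (smooth_differentiable (sx a openT) I).
Qed.

(** The Gram matrix of the frame with constant components [b0] in [c]; it is [minkowski] over the
    base point of [u]. *)
Let h y := b0^T *m metric c (x y) *m b0.

Let sg : smooth_mx V0 (fun y => metric c (x y)).
Proof.
apply: (smooth_mx_comp (U := chart_cod c)) => //.
- by move=> a; exact: sx.
- by move=> a b; exact: metric_smooth.
Qed.

Let sT : smooth_mx V0 (fun y => time_field c (x y)).
Proof.
apply: (smooth_mx_comp (U := chart_cod c)) => //.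
- by move=> a; exact: sx.
- by move=> a b; rewrite ord1; exact: time_field_smooth.
Qed.

Let sh : smooth_mx V0 h.
Proof. by apply: smooth_mxM => //; [apply: smooth_mxM => //|]; exact: smooth_mx_cst. Qed.

(** The domain shrinks in stages, each cut out by a strict inequality for a function smooth on the
    previous set: positive boost parameter, timelike first vector, Lorentzian Gram matrix,
    orientation, future direction. *)
Let V1 := V0 `&` [set y | 0 < y 0 o2].
Let oV1 : open V1. Proof. by apply: open_smooth_gt0 => //; exact: smooth_coord. Qed.
Let sh1 : smooth_mx V1 h. Proof. by apply: smooth_mx_subset sh => y []. Qed.

Let V2 := V1 `&` [set y | 0 < - h y 0 0].
Let oV2 : open V2. Proof. by apply: open_smooth_gt0 => //; exact: smoothN. Qed.
Let sh2 : smooth_mx V2 h. Proof. by apply: smooth_mx_subset sh1 => y []. Qed.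

Let D y := h y 0 1 ^+ 2 - h y 0 0 * h y 1 1.
Let sD : smooth_on V2 D.
Proof.
by rewrite /D; under eq_fun do rewrite expr2; apply: smoothB => //; exact: smoothM.
Qed.

Let V3 := V2 `&` [set y | 0 < D y].
Let oV3 : open V3. Proof. exact: open_smooth_gt0. Qed.
Let sh3 : smooth_mx V3 h. Proof. by apply: smooth_mx_subset sh2 => y []. Qed.

Let beta y := b0 *m gram_schmidt (h y) *m boost (y 0 o2).

Let sgs : smooth_mx V3 (fun y => gram_schmidt (h y)).
Proof.
have sp : smooth_on V3 (fun y => (Num.sqrt (- h y 0 0))^-1).
  by apply: smooth_invsqrt => // [y [[]]|] //; exact: smoothN.
have sq : smooth_on V3 (fun y => (Num.sqrt (D y))^-1).
  by apply: smooth_invsqrt => // [y []|] //; apply: smooth_on_subset sD => y [].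
apply: ord2_ind; apply: ord2_ind; under eq_fun do rewrite mxE /=.
- exact: sp.
- by apply: smoothM => //; exact: smoothM.
- exact: smooth_cst.
- by apply: smoothM => //; apply: smoothM => //; exact: smoothN.
Qed.

Let sboost : smooth_mx V3 (fun y => boost (y 0 o2)).
Proof.
have ss : smooth_on V3 (fun y => y 0 o2) by exact: smooth_coord.
have si : smooth_on V3 (fun y => (y 0 o2)^-1).
  by apply: smoothV => // y [[[_ /= s0] _] _]; rewrite gt_eqF.
move=> a b; under eq_fun do rewrite mxE.
case: (a == b); apply: smoothM => //; try exact: smooth_cst.
  exact: smoothD.
exact: smoothB.
Qed.

Let sbeta3 : smooth_mx V3 beta.
Proof.
by apply: smooth_mxM => //; apply: smooth_mxM => //; exact: smooth_mx_cst.
Qed.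

Let V4 := V3 `&` [set y | 0 < \det (beta y)].
Let oV4 : open V4. Proof. by apply: open_smooth_gt0 => //; exact: smooth_det. Qed.

Let tau y := - ((time_field c (x y))^T *m metric c (x y) *m col 0 (beta y)) 0 0.
Let V := V4 `&` [set y | 0 < tau y].

Let V30 : V3 `<=` V0. Proof. by move=> y [[[]]]. Qed.

Let oV : open V.
Proof.
apply: open_smooth_gt0 => //; apply: smoothN => //.
apply: (smooth_mx_subset (U := V3)) => [y [] //|].
apply: smooth_mxM => //; last exact: smooth_col.
apply: smooth_mxM => //; last exact: smooth_mx_subset sg.
by apply: smooth_mx_tr; exact: smooth_mx_subset sT.
Qed.

Let VV3 : V `<=` V3. Proof. by move=> y [[]]. Qed.

Let sbeta : smooth_mx V beta. Proof. exact: smooth_mx_subset sbeta3. Qed.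

Let beta_ortho y : V y -> (beta y)^T *m metric c (x y) *m beta y = minkowski R.
Proof.
move=> /VV3 [[[cy /= s0] a0] D0].
have -> : (beta y)^T *m metric c (x y) *m beta y = (boost (y 0 o2))^T *m
    ((gram_schmidt (h y))^T *m h y *m gram_schmidt (h y)) *m boost (y 0 o2).
  by rewrite /beta /h !trmx_mul !mulmxA.
rewrite gram_schmidt_ortho // ?boost_ortho ?gt_eqF //.
have congS (b A : 'M[R]_2) : A^T = A -> (b^T *m A *m b)^T = b^T *m A *m b.
  by move=> AS; rewrite !trmx_mul trmxK AS mulmxA.
exact: congS (metric_mx_sym ac (cy : chart_cod c (x y))).
Qed.

Let beta_unit y : V y -> beta y \in unitmx.
Proof. by case=> -[_ /= d0] _; rewrite unitmxE unitfE gt_eqF. Qed.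

Let beta0_unit y : V y -> b0 *m gram_schmidt (h y) \in unitmx.
Proof. by move=> /beta_unit; rewrite unitmx_mul => /andP[]. Qed.

Let y0 : 'rV[R]_3 := row_mx (coord c (frame_pt u)) (const_mx 1).

Let x0 : x y0 = coord c (frame_pt u).
Proof. by apply/rowP => a; rewrite [LHS]mxE; exact: row_mxEl. Qed.

Let s0 : y0 0 o2 = 1.
Proof.
have -> : o2 = rshift 2 (0 : 'I_1) by apply: val_inj.
by apply: etrans (row_mxEr _ _ _ _) _; rewrite mxE.
Qed.

Let h0 : h y0 = minkowski R.
Proof. by rewrite /h x0; exact: frame_comp_orthonormal. Qed.

Let b0E : b0 = frame_mx u.
Proof. by rewrite /b0 /frame_comp jac_id ?mul1mx //; exists (frame_pt u). Qed.

Let betay0 : beta y0 = b0.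
Proof. by rewrite /beta h0 s0 gram_schmidt_minkowski boost1 !mulmx1. Qed.

Let Vy0 : V y0.
Proof.
split; last by rewrite /= /tau betay0 x0 oppr_gt0 b0E; exact: frame_future.
split; last by rewrite /= betay0 b0E; exact: frame_oriented.
split; last by rewrite /= /D h0 !mxE /=; lra.
split; last by rewrite /= h0 !mxE /=; lra.
split; last by rewrite /= s0.
by rewrite /V0 /= x0; exists (frame_pt u).
Qed.

Let xE y : V y -> chart_dom c (coord_inv c (x y)) /\ coord c (coord_inv c (x y)) = x y.
Proof. by move=> /VV3/V30 [p cp <-]; rewrite coordK. Qed.

Let parametrized : exists psi : 'rV[R]_3 -> orthonormal_frame M, forall y, V y ->
  frame_pt (psi y) = coord_inv c (x y) /\ frame_comp c (psi y) = beta y.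
Proof.
suff /choice[psi Hpsi] : forall y, exists w : orthonormal_frame M, V y ->
    frame_pt w = coord_inv c (x y) /\ frame_comp c w = beta y by exists psi.
move=> y.
(* Off [V] the value is arbitrary, and [u] is at hand. *)
have [Vy|nVy] := pselect (V y); last by exists u.
have [dp cp] := xE Vy.
have [|||w Hw] := @frame_exists R M c (coord_inv c (x y)) (beta y) ac dp.
- by rewrite cp; exact: beta_ortho.
- by case: Vy => -[].
- by case: Vy => _; rewrite /= cp /tau oppr_gt0.
by exists w.
Qed.

Lemma local_parametrization_exists : exists psi V y,
  [/\ local_parametrization c psi V, V y & psi y = u].
Proof.
have [psi Hpsi] := parametrized; exists psi, V, y0.
have Hx y : V y -> base_coord c psi y = x y.
  by move=> Vy; rewrite /base_coord (Hpsi y Vy).1 (xE Vy).2.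
have Hb y : V y -> fibre_coord c psi y = beta y by move=> Vy; exact: (Hpsi y Vy).2.
split => //; last first.
  apply: (frame_comp_inj ac cu); last by rewrite (Hpsi _ Vy0).2 betay0.
  by rewrite (Hpsi _ Vy0).1 x0 coordK.
split => //.
- by move=> y Vy; rewrite (Hpsi y Vy).1; exact: (xE Vy).1.
- move=> a; apply: smooth_eq_on (sx a oV) => // y Vy; by rewrite Hx.
- by move=> a b; apply: smooth_eq_on (sbeta a b) => // y Vy; rewrite Hb.
- move=> y z Vy Vz yz.
  have xyz : x y = x z by rewrite -Hx // -Hx // /base_coord yz.
  have byz : beta y = beta z by rewrite -Hb // -Hb // /fibre_coord yz.
  have hyz : h y = h z by rewrite /h xyz.
  (* Over the same base point the Gram-Schmidt frames agree, so the boosts do; applying them to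
     (1,1) compares the parameters. *)
  have syz : y 0 o2 = z 0 o2.
    move: byz; rewrite /beta hyz => /(can_inj (mulKmx (beta0_unit Vz))).
    move=> /(congr1 (mulmx^~ (const_mx 1 : 'cV_2))); rewrite !boost_row.
    by move=> /matrixP /(_ 0 0); rewrite !mxE !mulr1.
  apply/rowP; apply: ord3_ind => //.
  + by have /rowP /(_ 0) := xyz; rewrite !mxE lift0.
  + by have /rowP /(_ 1) := xyz; rewrite !mxE lift1.
- move=> y Vy v H1 H2.
  have px i a : partial i (fun z => base_coord c psi z 0 a) y = (i == lshift 1 a)%:R.
    rewrite -(partial_coord i (lshift 1 a) y); apply: (eq_on_partial _ oV Vy) => z Vz.
    by rewrite Hx // mxE.
  have v01 (a : 'I_2) : v 0 (lshift 1 a : 'I_3) = 0.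
    transitivity ((\sum_(i < 3) v 0 i *: (tangent c psi i y).1) 0 a); last by rewrite H1 mxE.
    rewrite summxE (bigD1 (lshift 1 a : 'I_3)) //= big1 => [|i /negbTE ia].
      by rewrite !mxE px eqxx mulr1 addr0.
    by rewrite !mxE px ia mulr0.
  have v2 : v 0 o2 *: dmx o2 beta y = 0.
    have := H2; rewrite sum3 -lift0 -lift1 !v01 !scale0r !add0r.
    rewrite (_ : (tangent c psi o2 y).2 = dmx o2 beta y) //.
    exact: (eq_on_dmx oV o2 Vy Hb).
  pose e : 'cV[R]_2 := const_mx 1.
  (* Since [e] is an eigenvector of the boost, [beta e] is the boost parameter times [w], and [w]
     depends on the base point only. Its derivative in the third variable is therefore [w], which is
     nonzero. *)
  pose w z := b0 *m gram_schmidt (h z) *m e.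
  have sw : smooth_mx V w.
    apply: (smooth_mx_subset (U := V3)) => //.
    by do 2?apply: smooth_mxM => //; exact: smooth_mx_cst.
  have dw : dmx o2 w y = 0.
    apply/matrixP => a b; rewrite [LHS]mxE [RHS]mxE; apply: partial_invariant => t.
    suff xt : x (t *: delta_mx 0 o2 + y) = x y by rewrite /w /h xt.
    apply/rowP => j; rewrite !mxE eqxx /= (_ : lshift 1 j == o2 = false).
      by rewrite mulr0 add0r.
    by apply/negbTE; rewrite -val_eqE /= neq_ltn ltn_ord.
  have be z : beta z *m e = z 0 o2 *: w z.
    by rewrite /beta /w -mulmxA boost_row -scalemxAr.
  have dbe : dmx o2 beta y *m e = w y.
    rewrite -[LHS]addr0 -[X in _ + X](mulmx0 _ (beta y)) -(dmx_cst o2 y e).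
    rewrite -(dmxM o2 Vy sbeta (smooth_mx_cst oV e)).
    rewrite (eq_on_dmx oV o2 Vy (fun z _ => be z)).
    rewrite (dmxZ o2 Vy (smooth_coord oV o2) sw) dw scaler0 addr0 partial_coord.
    by rewrite eqxx scale1r.
  have v20 : v 0 o2 = 0.
    have : v 0 o2 *: w y = 0 by rewrite -dbe scalemxAl v2 mul0mx.
    move/(congr1 (mulmx (invmx (b0 *m gram_schmidt (h y))))).
    rewrite mulmx0 -scalemxAr /w mulKmx ?beta0_unit // => /matrixP /(_ 0 0).
    by rewrite !mxE mulr1.
  apply/rowP; apply: ord3_ind; rewrite [RHS]mxE //.
  + by rewrite -lift0.
  + by rewrite -lift1.
Qed.

End Existence.

Theorem mainTheorem3 (R : realType) (M : lorentzian_surface R)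
    (u : orthonormal_frame M) :
  schmidt_ricci_scalar u = - (1 / 8) * ricci_scalar (frame_pt u) ^+ 2 - 2.
Proof.
have [psi [V [y [lp Vy yu]]]] := local_parametrization_exists u.
apply: xget_unique.
  exists psi, V, y; split => //.
  by rewrite (local_schmidt_scalar (atlas_chart_at _) lp Vy) yu.
move=> _ [psi' [V' [y' [lp' Vy' yu' ->]]]].
by rewrite (local_schmidt_scalar (atlas_chart_at _) lp' Vy') yu'.
Qed.
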